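(* Let $P(t)=\sum_{j=1}^{r}\binom{t+b_j-(j-1)}{b_j}$ be an admissible Hilbert polynomial, written in its Gotzmann expression with integers $b_1\ge b_2\ge\dots\ge b_r\ge 0$, let $c$ be a positive integer, and let $n:=c+\deg P$. Let $s$ be the integer with $b_1=b_2=\dots=b_s>b_{s+1}\ge\dots\ge b_r$ (so $s=r$ if all $b_j$ are equal). Then the lexicographic ideal $L^{P}_n\subset\Bbbk[x_0,\dots,x_n]$ is the unique saturated Borel ideal of $\Bbbk[x_0,\dots,x_n]$ (i.e. the unique saturated Borel ideal of codimension $c$) with Hilbert polynomial $P$ if and only if one of the following holds: (i) $c\ge 2$ and either $b_r>0$ or $r\le 2$; or (ii) $c=1$ and either $b_r>0$, or $b_1=b_r$, or $r-s\le 2$.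
   Context: $\Bbbk$ is an algebraically closed field and $\Bbbk[x_0,\dots,x_n]$ is the standard graded polynomial ring. For a homogeneous ideal $I$, $P_I$ denotes the Hilbert polynomial of $\Bbbk[x_0,\dots,x_n]/I$. Binomial coefficients are polynomials in $t$: for integers $a,b$, $\binom{t+a}{b}=\frac{(t+a)(t+a-1)\cdots(t+a-b+1)}{b!}$ if $b\ge 0$ and $0$ if $b<0$. A polynomial is an admissible Hilbert polynomial if it is the Hilbert polynomial of a nonempty closed subscheme of some projective space; each such $P$ has a unique Gotzmann expression $P(t)=\sum_{j=1}^r\binom{t+b_j-(j-1)}{b_j}$ with $b_1\ge\dots\ge b_r\ge 0$ (then $\deg P=b_1$). A monomial ideal $I$ is Borel if for every monomial $m\in I$, every variable $x_j$ dividing $m$ and every $i<j$, we have $m x_i/x_j\in I$. $I$ is saturated if $(I:\langle x_0,\dots,x_n\rangle^\infty)=I$. Lexicographic order on monomials: $x^u>x^v$ if the first nonzero coordinate of $u-v$ is positive (so $x_0>x_1>\dots>x_n$). For a homogeneous ideal $I\subseteq\Bbbk[x_0,\dots,x_n]$ with Hilbert function $H$, let $L^H_n$ be the monomial ideal whose degree-$i$ piece is spanned by the $\dim_\Bbbk I_i$ lexicographically largest monomials of degree $i$; for an admissible Hilbert polynomial $P$ with $\deg P<n$, the lexicographic ideal $L^P_n$ is the saturation of $L^{H_I}_n$ with respect to $\langle x_0,\dots,x_n\rangle$ for any homogeneous ideal $I$ with Hilbert polynomial $P$ (it depends only on $P$ and $n$, and has Hilbert polynomial $P$). The codimension of an ideal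 of $\Bbbk[x_0,\dots,x_n]$ with Hilbert polynomial $P$ is $n-\deg P$. *)

(* Defs.v *)
From HB Require Import structures.
From mathcomp Require Import all_boot all_order all_algebra.
From mathcomp Require Export mpoly.
Set Implicit Arguments. Unset Strict Implicit. Unset Printing Implicit Defensive.
Import GRing.Theory.
Local Open Scope ring_scope.

Section Ideals.
Variables (k : fieldType) (nv : nat).
Notation poly := {mpoly k[nv]}.

Definition is_ideal (I : poly -> Prop) : Prop :=
  I 0 /\ (forall f g, I f -> I g -> I (f + g)) /\ (forall f g, I f -> I (g * f)).

(* homogeneous of degree t (0 is homogeneous of every degree) *)
Definition is_homog_of (t : nat) (p : poly) : bool :=
  all (fun m => mdeg m == t) (msupp p).

Definition hcomp (t : nat) (f : poly) : poly :=
  \sum_(m <- msupp f | mdeg m == t) f@_m *: 'X_[m].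

Definition is_homog_ideal (I : poly -> Prop) : Prop :=
  is_ideal I /\ (forall f t, I f -> I (hcomp t f)).

Definition indep_mod (I : poly -> Prop) (s : seq poly) : Prop :=
  forall c : seq k, size c = size s ->
    I (\sum_(i < size s) c`_i *: s`_i) -> forall i, c`_i = 0.

(* hilb_fun I t h : dim_k (k[x]/I)_t = h  (maximal number of degree-t forms
   linearly independent modulo I) *)
Definition hilb_fun (I : poly -> Prop) (t h : nat) : Prop :=
  (exists s : seq poly, size s = h /\ all (is_homog_of t) s /\ indep_mod I s) /\
  (forall s : seq poly, all (is_homog_of t) s -> indep_mod I s -> (size s <= h)%N).

(* values of the Gotzmann polynomial sum_{j=1}^r binom(t+b_j-(j-1), b_j)
   (indices shifted to 0-based j); for t >= r the natural-number
   binomial below coincides with the value of the binomial polynomial. *)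
Definition gotz (b : seq nat) (t : nat) : nat :=
  (\sum_(j < size b) 'C(t + nth 0 b j - j, nth 0 b j))%N.

Definition has_hilb_poly (I : poly -> Prop) (b : seq nat) : Prop :=
  exists t0, forall t, (t0 <= t)%N -> hilb_fun I t (gotz b t).

Definition lexgt (u v : 'X_{1..nv}) : bool :=
  [exists i : 'I_nv, [forall j : 'I_nv, (j < i)%N ==> (u j == v j)] && (v i < u i)%N].

Definition monos (t : nat) : {set 'X_{1..nv < t.+1}} :=
  [set m : 'X_{1..nv < t.+1} | mdeg m == t].

(* L^{H_I}: degree-t piece spanned by the dim I_t = #monos t - H_I(t)
   lex-largest monomials of degree t *)
Definition lex_ideal (I : poly -> Prop) : poly -> Prop := fun f =>
  forall m, m \in msupp f -> exists h, hilb_fun I (mdeg m) h /\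
    (#|[set m' in monos (mdeg m) | lexgt m' m]| < #|monos (mdeg m)| - h)%N.

Definition sat (I : poly -> Prop) : poly -> Prop := fun f =>
  exists K, forall m : 'X_{1..nv}, mdeg m = K -> I (f * 'X_[m]).

Definition saturated (I : poly -> Prop) : Prop := forall f, sat I f <-> I f.

Definition monomial_ideal (I : poly -> Prop) : Prop :=
  is_ideal I /\ (forall f, I f <-> (forall m, m \in msupp f -> I 'X_[m])).

Definition borel (I : poly -> Prop) : Prop :=
  monomial_ideal I /\
  (forall (m : 'X_{1..nv}) (i j : 'I_nv), I 'X_[m] -> (i < j)%N -> (0 < m j)%N ->
     I 'X_[(m - U_(j) + U_(i))%MM]).

End Ideals.

Definition lex_unique_cond (b : seq nat) (c : nat) : Prop :=
  let r := size b in
  let s := count (fun x => x == head 0%N b) b in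
  ((2 <= c)%N /\ ((0 < last 0%N b)%N \/ (r <= 2)%N)) \/
  (c = 1%N /\ ((0 < last 0%N b)%N \/ head 0%N b = last 0%N b \/ (r - s <= 2)%N)).

(* Main.v *)
Require Import Defs.
From HB Require Import structures.
From mathcomp Require Import all_boot all_order all_algebra zify.
From mathcomp Require Import mpoly.
From Stdlib Require Import ClassicalEpsilon FunctionalExtensionality PropExtensionality.
Set Implicit Arguments. Unset Strict Implicit. Unset Printing Implicit Defensive.
Import Order.TTheory GRing.Theory.

(* Let [a_i] be the number of [b_j] equal to [n - 1 - i]. The lexicographic ideal consists of
   the monomials [m] with [(m_0, .., m_(n-1)) >= (a_0, .., a_(n-1))] lexicographically; that the
   saturation of [L^H] is this ideal follows from Macaulay's theorem applied to leading
   monomials. Macaulay's theorem is reduced to strongly stable sets by two-variable compressions,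
   and proved there by Bigatti's argument on the monomials free of the last variable. The
   condition of the theorem says that [a_(n-1) = 0] or [a_1 + .. + a_(n-1) <= 2].

   A saturated Borel ideal is a Borel set [A] of monomials in [x_0, .., x_(n-1)], and the Hilbert
   polynomial determines [sum_(s <= t) #A_s] for large [t]. Replacing [a_(n-1)] by 0 gives a
   lexicographic ideal which is saturated in these [n] variables and therefore maximal in every
   degree; it agrees with the original one outside the degrees [a_0 + .. + a_(n-2) <= s < a_0 +
   .. + a_(n-1)]. On the other hand [A] lies in [(x_0^a_0)], so in degrees at most [a_0 + 1]
   it is comparable with the lexicographic ideal. Under the condition this forces
   [#A_s <= #L_s] in each degree, hence equality, and equality of Hilbert functions forces
   [A = L]. If the condition fails, lower [a_(n-1)] by 1 and remove, instead of the lex-smallest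
   generator, the lex-smallest element of degree [a_0 + 1]. *)

(** * Monomials as exponent lists *)

Fixpoint mons (N t : nat) : seq (seq nat) :=
  if N is N'.+1 then flatten [seq [seq x :: m | m <- mons N' (t - x)] | x <- iota 0 t.+1]
  else if t is 0 then [:: [::]] else [::].

Lemma mem_mons N t m : (m \in mons N t) = (size m == N) && (sumn m == t).
Proof.
elim: N t m => [|N IH] t m; first by case: t => [|t]; case: m.
apply/flatten_mapP/idP => [[x]|].
  rewrite mem_iota => /andP[_ xt] /mapP[m']; rewrite IH => /andP[/eqP sm /eqP um] -> /=.
  by rewrite sm um eqxx /=; lia.
case: m => [|x m] // /andP[/eqP [sm] /eqP um]; exists x; first by move: um; rewrite mem_iota /=; lia.
by apply: map_f; move: um; rewrite IH sm eqxx /=; lia.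
Qed.

Lemma uniq_mons N t : uniq (mons N t).
Proof.
elim: N t => [|N IH] t; first by case: t.
rewrite [mons _ _]/(flatten [seq [seq x :: m | m <- mons N (t - x)] | x <- iota 0 t.+1]).
have := iota_uniq 0 t.+1; elim: (iota 0 t.+1) => //= x s IHs /andP[xs us].
rewrite cat_uniq IHs // map_inj_uniq ?IH //; last by move=> ? ? [].
rewrite andbT; apply/hasPn => m /flatten_mapP[y ys] /mapP[m' _ ->]; apply/negP => /mapP[m2 _ [yx _]].
by move: xs; rewrite -yx ys.
Qed.

Arguments mons : simpl never.

Lemma big_mons_cat (F : seq nat -> nat) p q t :
  \sum_(m <- mons (p + q) t) F m =
  \sum_(s < t.+1) \sum_(u <- mons p s) \sum_(w <- mons q (t - s)) F (u ++ w).
Proof.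
have -> : \sum_(s < t.+1) \sum_(u <- mons p s) \sum_(w <- mons q (t - s)) F (u ++ w) =
  \sum_(m <- flatten [seq [seq u ++ w | u <- mons p s, w <- mons q (t - s)] | s <- iota 0 t.+1]) F m.
  rewrite big_flatten big_map (_ : iota 0 t.+1 = index_iota 0 t.+1); last by rewrite /index_iota subn0.
  rewrite big_mkord; apply: eq_bigr => s _.
  by rewrite big_allpairs_dep.
apply: perm_big; apply: uniq_perm; first exact: uniq_mons.
  have := iota_uniq 0 t.+1; elim: (iota 0 t.+1) => //= s l IHl /andP[sl ul].
  rewrite cat_uniq IHl // andbT; apply/andP; split.
    apply: allpairs_uniq; try exact: uniq_mons.
    move=> [u w] [u' w'] /allpairsP[[x y] [/= + _ [-> ->]]] /allpairsP[[x' y'] [/= + _ [-> ->]]] /= e.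
    rewrite !mem_mons => /andP[/eqP s1 _] /andP[/eqP s2 _].
    by move/eqP: e; rewrite eqseq_cat ?s1 ?s2 // => /andP[/eqP -> /eqP ->].
  apply/hasPn => m /flatten_mapP[s' s'l] /allpairsP[[u w] [/= + _ ->]].
  rewrite mem_mons => /andP[/eqP su /eqP tu]; apply/negP => /allpairsP[[u' w'] [/= + _ e]].
  rewrite mem_mons => /andP[/eqP su' /eqP tu'].
  move/eqP: e; rewrite eqseq_cat ?su ?su' // => /andP[/eqP uu _].
  by move: sl; rewrite -tu' -uu tu s'l.
move=> m; rewrite mem_mons; apply/idP/flatten_mapP => [/andP[/eqP sm /eqP um]|].
  have e : sumn (take p m) + sumn (drop p m) = sumn m by rewrite -sumn_cat cat_take_drop.
  exists (sumn (take p m)); first by rewrite mem_iota; lia.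
  apply/allpairsP; exists (take p m, drop p m); rewrite /= cat_take_drop !mem_mons eqxx andbT.
  split => //; first by rewrite size_takel ?sm ?leq_addr.
  by rewrite size_drop sm addKn eqxx -um -e addKn eqxx.
case=> s; rewrite mem_iota => st /allpairsP[[u w] [/=]].
rewrite !mem_mons => /andP[/eqP su /eqP tu] /andP[/eqP sw /eqP tw] ->.
by rewrite size_cat sumn_cat su sw tu tw eqxx /=; lia.
Qed.

Lemma mons1 t : mons 1 t = [:: [:: t]].
Proof.
apply: perm_small_eq => //; apply: uniq_perm => //; first exact: uniq_mons.
by move=> [|x [|y m]]; rewrite mem_mons inE //= ?addn0 eqseq_cons ?andbT // andbF.
Qed.

Lemma big_mons_cons (F : seq nat -> nat) N t :
  \sum_(m <- mons N.+1 t) F m = \sum_(s < t.+1) \sum_(w <- mons N (t - s)) F ((s : nat) :: w).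
Proof.
by rewrite -add1n big_mons_cat; apply: eq_bigr => s _; rewrite mons1 big_seq1.
Qed.

Lemma big_mons_rcons (F : seq nat -> nat) N t :
  \sum_(m <- mons N.+1 t) F m = \sum_(s < t.+1) \sum_(w <- mons N (t - s)) F (rcons w (s : nat)).
Proof.
rewrite -addn1 big_mons_cat (reindex_inj rev_ord_inj) /=; apply: eq_bigr => s _.
rewrite subSS; apply: eq_bigr => w _; rewrite (_ : t - (t - s) = s); last by have := ltn_ord s; lia.
by rewrite mons1 big_seq1 cats1.
Qed.

Lemma count_sum (T : Type) (A : pred T) s : count A s = \sum_(m <- s) A m.
Proof. by elim: s => [|x s IH]; rewrite ?big_nil ?big_cons //= IH. Qed.

Lemma count_mons_cons (A : pred (seq nat)) N t :
  count A (mons N.+1 t) = \sum_(s < t.+1) count (fun w => A ((s : nat) :: w)) (mons N (t - s)).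
Proof. by rewrite count_sum big_mons_cons; apply: eq_bigr => s _; rewrite count_sum. Qed.

Lemma count_mons_rcons (A : pred (seq nat)) N t :
  count A (mons N.+1 t) = \sum_(s < t.+1) count (fun w => A (rcons w (s : nat))) (mons N (t - s)).
Proof. by rewrite count_sum big_mons_rcons; apply: eq_bigr => s _; rewrite count_sum. Qed.

Lemma size_mons N t : size (mons N.+1 t) = 'C(t + N, N).
Proof.
elim: N t => [|N IH] t; first by rewrite mons1 bin0.
rewrite -count_predT count_mons_cons (reindex_inj rev_ord_inj) /=.
rewrite (eq_bigr (fun s : 'I_t.+1 => 'C(s + N, N))); last first.
  by move=> s _; rewrite count_predT subSS IH subKn // -ltnS.
elim: t => [|t IHt]; first by rewrite big_ord1 add0n !binn.
by rewrite big_ord_recr /= IHt [in RHS]addSn binS -addSnnS.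
Qed.

Lemma leq_count (T : eqType) (A B : pred T) s :
  {in s, forall x, A x -> B x} -> count A s <= count B s.
Proof.
by move=> h; rewrite !count_sum big_seq [leqRHS]big_seq; apply: leq_sum => x xs; case: (A x) (h x xs) => // ->.
Qed.

Lemma eq_count_sub (T : eqType) (A B : pred T) s :
  {in s, forall x, A x -> B x} -> count B s <= count A s -> {in s, A =1 B}.
Proof.
elim: s => [|x s IH] // h /= c y; rewrite inE.
have h' : {in s, forall x, A x -> B x} by move=> z zs; apply: h; rewrite inE zs orbT.
have le := leq_count h'; have hx := h x (mem_head _ _).
by case/predU1P=> [->|ys]; [|apply: IH => //]; move: hx c; case: (A x) (B x) => [] [] //=; lia.
Qed.

Lemma ltn_sum_seq (T : eqType) (F G : T -> nat) s x :
  {in s, forall y, F y <= G y} -> x \in s -> F x < G x -> \sum_(y <- s) F y < \sum_(y <- s) G y.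
Proof.
move=> h xs lt; rewrite !(big_rem x xs) /=.
rewrite -addSn leq_add //; rewrite big_seq [leqRHS]big_seq; apply: leq_sum => y yr.
by apply: h; apply: mem_rem yr.
Qed.

Lemma leq_sum_seq (T : eqType) (F G : T -> nat) s :
  {in s, forall y, F y <= G y} -> \sum_(y <- s) F y <= \sum_(y <- s) G y.
Proof. by move=> h; rewrite big_seq [leqRHS]big_seq; apply: leq_sum. Qed.

Lemma ltn_sum_ord n (F G : 'I_n -> nat) i :
  (forall j, F j <= G j) -> F i < G i -> \sum_(j < n) F j < \sum_(j < n) G j.
Proof. by move=> h lt; rewrite (bigD1 i) //= [ltnRHS](bigD1 i) //= -addSn leq_add // leq_sum. Qed.

(** * Lexicographic and dominance orders *)

(* When the lists have different lengths only the common prefix is compared, so that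
   [lexge m a] with [size a < size m] ignores the last variables of [m]. *)
Fixpoint lexge (u v : seq nat) : bool :=
  match u, v with
  | x :: u', y :: v' => (y < x) || ((x == y) && lexge u' v')
  | _, _ => true
  end.

Lemma lexge_refl u : lexge u u.
Proof. by elim: u => //= x u ->; rewrite eqxx orbT. Qed.

Lemma lexge_total u v : lexge u v || lexge v u.
Proof. by elim: u v => [|x u IH] [|y v] //=; have := IH v; case: ltngtP. Qed.

Lemma lexge_anti u v : size u = size v -> lexge u v -> lexge v u -> u = v.
Proof.
elim: u v => [|x u IH] [|y v] //= [suv]; case: ltngtP => //= -> h1 h2.
by rewrite (IH v).
Qed.

(** A middle list shorter than [w] would compare favourably with anything past its end, and
    transitivity would fail; the length hypothesis excludes this. *)
Lemma lexge_trans v u w : size w <= size v -> lexge u v -> lexge v w -> lexge u w.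
Proof.
elim: u v w => [|x u IH] [|y v] [|z w] //= s.
case/orP=> [yx|/andP[/eqP<- uv]]; case/orP=> [zy|/andP[/eqP zy vw]].
- by rewrite (ltn_trans zy yx).
- by rewrite -zy yx.
- by rewrite zy.
- by rewrite zy eqxx (IH v) ?orbT.
Qed.

Lemma lexge_notl m u a : size a <= size m -> size a <= size u -> ~~ lexge m a -> lexge u a -> lexge u m.
Proof.
move=> s1 s2 nm ua; case/orP: (lexge_total u m) => // mu.
by case/negP: nm; apply: lexge_trans mu ua.
Qed.

Lemma lexge_rcons u v x y : size u = size v ->
  lexge (rcons u x) (rcons v y) = lexge u v && ((u == v) ==> (y <= x)).
Proof.
elim: u v => [|a u IH] [|b v] //=; first by rewrite andbT; case: ltngtP.
case=> suv.
by rewrite IH // eqseq_cons; case: ltngtP.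
Qed.

Lemma lexge_rconsl u w x : size w <= size u -> lexge (rcons u x) w = lexge u w.
Proof. by elim: u w => [|y u IH] [|z w] //= s; rewrite IH. Qed.

Lemma lexge_sum0 v w : sumn w = 0 -> lexge v w.
Proof. by elim: v w => [|x v IH] [|y w] //= h; rewrite IH; lia. Qed.

Definition dominates (u v : seq nat) := forall i, sumn (take i v) <= sumn (take i u).

Lemma dominates_sumn u v : size u = size v -> dominates u v -> sumn v <= sumn u.
Proof. by move=> s /(_ (size u)); rewrite {1}s !take_size. Qed.

Lemma dominates_lexge u v : dominates u v -> lexge u v.
Proof.
elim: u v => [|x u IH] [|y v] //= d; have := d 1; rewrite /= !take0 /= !addn0.
rewrite leq_eqVlt => /predU1P[yx|->] //; rewrite yx eqxx IH ?orbT // => i.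
by have := d i.+1; rewrite /= yx leq_add2l.
Qed.

Lemma dominates_cons u v x y : y <= x -> dominates u v -> dominates (x :: u) (y :: v).
Proof. by move=> yx d [|i] //=; rewrite leq_add. Qed.

Lemma dominates_cons_inv u v x : dominates (x :: u) (x :: v) -> dominates u v.
Proof. by move=> d i; have := d i.+1; rewrite /= leq_add2l. Qed.

Lemma dominates_rcons u v x y : size u = size v -> dominates u v ->
  sumn v + y <= sumn u + x -> dominates (rcons u x) (rcons v y).
Proof.
move=> s d h i; rewrite -!cats1 !take_cat s; case: ltnP => // le.
have := d (size v); rewrite take_size -s take_size !sumn_cat.
by case: (i - size u) => [|[|j]] /=; lia.
Qed.

(* Closure under [dominates] is equivalent to strong stability under the moves [x_j -> x_i],
   [i < j]; for unequal degrees it also expresses closure under multiplication. *)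
Definition borel_at N t (A : pred (seq nat)) :=
  forall u v, u \in mons N t -> v \in mons N t -> dominates u v -> A v -> A u.

Definition lexseg_at N t (A : pred (seq nat)) :=
  forall u v, u \in mons N t -> v \in mons N t -> lexge u v -> A v -> A u.

Lemma lexseg_borel N t A : lexseg_at N t A -> borel_at N t A.
Proof. by move=> L u v um vm d; apply: L => //; apply: dominates_lexge. Qed.

Lemma size_mem_mons N t m : m \in mons N t -> size m = N.
Proof. by rewrite mem_mons => /andP[/eqP]. Qed.

Lemma sumn_mem_mons N t m : m \in mons N t -> sumn m = t.
Proof. by rewrite mem_mons => /andP[_ /eqP]. Qed.

(** Lex segments form a chain: a member of [A] outside [B] lies below all of [B], so [B] is
    contained in [A], and the sizes then force equality. *)
Lemma lexseg_nested N t A B : lexseg_at N t A -> lexseg_at N t B ->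
  count A (mons N t) <= count B (mons N t) -> {in mons N t, forall m, A m -> B m}.
Proof.
move=> sA sB c m mm Am; apply/idPn => nB.
have BA : {in mons N t, forall u, B u -> A u}.
  move=> u um Bu; case/orP: (lexge_total u m) => h; first exact: sA h Am.
  by rewrite (sB m u) in nB.
by move: nB; rewrite (eq_count_sub BA c mm) Am.
Qed.

(** Transitivity is asked only on [s] because [lexge] has it only for lists of suitable lengths. *)
Lemma extremum_exists (T : eqType) (r : rel T) (s : seq T) (P : pred T) :
  reflexive r -> total r -> {in s & &, transitive r} -> has P s ->
  exists m, [/\ m \in s, P m & {in s, forall u, P u -> r m u}].
Proof.
move=> rr rt; elim: s => //= x s IH tr.
have tr' : {in s & &, transitive r} by move=> a b c sa sb sc; apply: tr; rewrite inE ?sa ?sb ?sc orbT.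
have [hs _|hs] := boolP (has P s); last first.
  rewrite orbF => Px; exists x; rewrite mem_head; split=> // u; rewrite inE => /predU1P[->|us] Pu //.
  by case/hasP: hs; exists u.
have [m [ms Pm mx]] := IH tr' hs.
have ms' : m \in x :: s by rewrite inE ms orbT.
have [/andP[Px xm]|nx] := boolP (P x && r x m).
  exists x; rewrite mem_head; split=> // u; rewrite inE => /predU1P[->|us] Pu //.
  by apply: (tr m) xm (mx _ us Pu); rewrite ?mem_head // inE us orbT.
exists m; split=> // u; rewrite inE => /predU1P[->|us] Pu; last exact: mx.
by move: nx; rewrite Pu /=; case/orP: (rt m x) => // ->.
Qed.

Lemma lexmax_exists (s : seq (seq nat)) n (P : pred (seq nat)) :
  {in s, forall m, size m = n} -> has P s ->
  exists m, [/\ m \in s, P m & {in s, forall u, P u -> lexge m u}].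
Proof.
move=> sz; apply: extremum_exists; [exact: lexge_refl|exact: lexge_total|].
by move=> v u w vs us ws; apply: lexge_trans; rewrite !sz.
Qed.

Lemma lexmin_exists (s : seq (seq nat)) n (P : pred (seq nat)) :
  {in s, forall m, size m = n} -> has P s ->
  exists m, [/\ m \in s, P m & {in s, forall u, P u -> lexge u m}].
Proof.
move=> sz; apply: (@extremum_exists _ (fun u v => lexge v u)); first exact: lexge_refl.
  by move=> u v; rewrite orbC lexge_total.
by move=> v u w vs us ws uv vw; apply: lexge_trans vw uv; rewrite !sz.
Qed.

Lemma count_add1 (T : eqType) (A : pred T) s x : uniq s -> x \in s -> ~~ A x ->
  count (fun y => A y || (y == x)) s = (count A s).+1.
Proof.
move=> us xs nA; rewrite -addn1 -[X in _ + X](_ : count_mem x s = 1); last by rewrite count_uniq_mem ?xs.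
rewrite -count_predUI (@eq_count _ (predI A (pred1 x)) pred0) ?count_pred0 ?addn0 //.
by move=> y /=; case: eqP => [->|]; rewrite ?andbF // (negbTE nA).
Qed.

(** The segment grows by the lex-largest monomial not yet taken. *)
Lemma lexseg_exists N t k : k <= size (mons N t) ->
  exists2 A, lexseg_at N t A & count A (mons N t) = k.
Proof.
elim: k => [_|k IH lt]; first by exists pred0 => //; rewrite count_pred0.
have [A sA cA] := IH (ltnW lt).
have hP : has (predC A) (mons N t) by rewrite has_count -(ltn_add2l (count A (mons N t))) count_predC cA addn0.
have [w [wm /= nw mx]] := lexmax_exists (@size_mem_mons N t) hP.
exists (fun y => A y || (y == w)); last by rewrite count_add1 ?cA ?uniq_mons.
move=> u v um vm uv /orP[Av|/eqP vw]; first by rewrite (sA u v).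
have [//|nu] := boolP (A u); apply/eqP/lexge_anti; rewrite ?(size_mem_mons um) ?(size_mem_mons wm) // -?vw //.
by rewrite vw; apply: mx.
Qed.

(** Products of a member of [A] with one variable, found by lowering each positive exponent in turn,
    so that membership stays boolean. *)
Fixpoint shadow (A : pred (seq nat)) (m : seq nat) : bool :=
  if m is x :: m' then ((0 < x) && A (x.-1 :: m')) || shadow (fun w => A (x :: w)) m' else false.

Lemma shadowP (A : pred (seq nat)) m :
  reflect (exists p x q, m = p ++ x.+1 :: q /\ A (p ++ x :: q)) (shadow A m).
Proof.
elim: m A => [|y m IH] A /=; first by right=> -[[|? ?] [? [? []]]].
apply: (iffP orP) => [[/andP[y0 Ay]|/IH[p [x [q [-> h]]]]]|].
- by exists [::], y.-1, m; rewrite /= prednK.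
- by exists (y :: p), x, q.
- case=> [[|z p] [x [q [/= [e1 e2] h]]]]; first by left; rewrite e1 e2.
  by right; apply/IH; exists p, x, q; rewrite e1.
Qed.

Lemma dec_mons N t p x q : (p ++ x.+1 :: q \in mons N t.+1) = (p ++ x :: q \in mons N t).
Proof. by rewrite !mem_mons !size_cat !sumn_cat /= addSn (addnS (sumn p)) eqSS. Qed.

Lemma shadow_rcons A m x : shadow A (rcons m x) =
  shadow (fun w => A (rcons w x)) m || ((0 < x) && A (rcons m x.-1)).
Proof.
elim: m A => [|y m IH] A /=; first by rewrite orbF.
by rewrite IH orbA.
Qed.

Lemma sumn_gt0P v : 0 < sumn v -> exists p x q, v = p ++ x.+1 :: q.
Proof.
elim: v => //= y v IH; case: y => [|y] h; last by exists [::], y, v.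
by have [p [x [q ->]]] := IH h; exists (0 :: p), x, q.
Qed.

(** After a strict inequality of entries, a later entry of [v] is lowered if one is positive.
    Otherwise the larger entry itself is lowered; should this give a tie, equality of degrees makes
    the rest of the other monomial zero. *)
Lemma lexge_dec v p x q : size v = size (p ++ x.+1 :: q) -> sumn v = sumn (p ++ x.+1 :: q) ->
  lexge v (p ++ x.+1 :: q) -> exists p' x' q', v = p' ++ x'.+1 :: q' /\ lexge (p' ++ x' :: q') (p ++ x :: q).
Proof.
elim: p v => [|z p IH] [|y v] //= [sz] sm.
  case: y sm => [|y] //= sm h; exists [::], y, v; split=> //=.
case/orP=> [zy|/andP[/eqP zy vu]]; last first.
  have [||p' [x' [q' [-> h]]]] := IH v _ _ vu; try lia.
  by exists (y :: p'), x', q'; rewrite /= zy eqxx h orbT.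
have [v0|/sumn_gt0P[p' [x' [q' ->]]]] := posnP (sumn v); last first.
  by exists (y :: p'), x', q'; rewrite /= zy.
case: y zy sm => // y zy sm; exists [::], y, v; split=> //=.
move: sm; rewrite v0 sumn_cat /= => sm.
have [//|yz] := ltnP z y; rewrite (_ : y == z) /=; last lia.
by apply: lexge_sum0; rewrite sumn_cat /=; lia.
Qed.

Lemma lexseg_shadow N t A : lexseg_at N t A -> lexseg_at N t.+1 (shadow A).
Proof.
move=> sA u v um vm uv /shadowP[p [x [q [ev Aq]]]]; apply/shadowP.
move: uv vm; rewrite ev => uv vm.
have [||p' [x' [q' [eu h]]]] := lexge_dec _ _ uv.
- by rewrite (size_mem_mons um) (size_mem_mons vm).
- by rewrite (sumn_mem_mons um) (sumn_mem_mons vm).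
exists p', x', q'; split=> //; apply: sA h Aq; rewrite -dec_mons //.
by rewrite -eu.
Qed.

(** * Macaulay's theorem for strongly stable sets *)

Lemma mons_rcons N t w x : x <= t -> (rcons w x \in mons N.+1 t) = (w \in mons N (t - x)).
Proof. by move=> xt; rewrite !mem_mons size_rcons eqSS sumn_rcons; congr (_ && _); lia. Qed.

Lemma borel_rcons N t A x : x <= t -> borel_at N.+1 t A -> borel_at N (t - x) (fun w => A (rcons w x)).
Proof.
move=> xt bA u v um vm d; apply: bA; rewrite ?mons_rcons //; apply: dominates_rcons => //.
  by rewrite (size_mem_mons um) (size_mem_mons vm).
by rewrite (sumn_mem_mons um) (sumn_mem_mons vm).
Qed.

Lemma lexseg_rcons N t A x : x <= t -> lexseg_at N.+1 t A -> lexseg_at N (t - x) (fun w => A (rcons w x)).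
Proof.
move=> xt bA u v um vm d; apply: bA; rewrite ?mons_rcons // lexge_rcons ?d ?leqnn ?implybT //.
by rewrite (size_mem_mons um) (size_mem_mons vm).
Qed.

(** Trading one factor of the last variable for an earlier variable is a Borel move. *)
Lemma borel_shadow_slice N t A x : x < t -> borel_at N.+1 t A ->
  {in mons N (t - x), forall m, shadow (fun w => A (rcons w x.+1)) m -> A (rcons m x)}.
Proof.
move=> xt bA m mm /shadowP[p [y [q [e Aq]]]].
have wm : p ++ y :: q \in mons N (t - x.+1) by rewrite -dec_mons subnSK // -e.
apply: bA Aq; rewrite ?mons_rcons // 1?ltnW //.
apply: dominates_rcons; first by rewrite e !size_cat.
  move=> i; rewrite e !take_cat; case: ltnP => // _; rewrite !sumn_cat leq_add2l.
  by case: (i - size p) => [|j] //=; rewrite leq_add2r.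
by rewrite e !sumn_cat /=; lia.
Qed.

(** By [borel_shadow_slice], a product divisible by the last variable is already the last variable
    times a member of [A]. What remains is the shadow, in the other variables, of the members free
    of the last one. *)
Lemma count_shadow_borel N t A : borel_at N.+1 t A ->
  count (shadow A) (mons N.+1 t.+1) =
  count (shadow (fun w => A (rcons w 0))) (mons N t.+1) + count A (mons N.+1 t).
Proof.
move=> bA; rewrite !count_mons_rcons big_ord_recl subn0; congr (_ + _).
  by apply: eq_count => w; rewrite shadow_rcons orbF.
apply: eq_bigr => j _; rewrite subSS; apply: eq_in_count => w wm.
rewrite shadow_rcons /=; case: (boolP (A (rcons w j))); rewrite ?orbT // orbF => nA.
have [jt|tj] := ltnP j t.
  by apply/negP => /(borel_shadow_slice jt bA wm) h; rewrite h in nA.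
(* Here [j = t], so [w] has degree 0 and no entry can be lowered. *)
apply/negP => /shadowP[p [y [q [e _]]]].
by move: (sumn_mem_mons wm); rewrite e sumn_cat /=; lia.
Qed.

Definition macaulay_borel_in N := forall t A L, borel_at N t A -> lexseg_at N t L ->
  count L (mons N t) <= count A (mons N t) ->
  count (shadow L) (mons N t.+1) <= count (shadow A) (mons N t.+1).

(** Bigatti's comparison. It is named, like [macaulay_borel_in], because the two statements are
    proved alternately: this one in [N.+1] variables follows from Macaulay's bound in [N]. *)
Definition slice_bound_in N := forall t A L, borel_at N.+1 t A -> lexseg_at N.+1 t L ->
  count L (mons N.+1 t) <= count A (mons N.+1 t) ->
  count (fun w => L (rcons w 0)) (mons N t) <= count (fun w => A (rcons w 0)) (mons N t).

(** By contradiction: if the slice of [L] at exponent 0 is strictly larger than that of [A], then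
    every slice of [L] is at least as large as that of [A], and summing contradicts the comparison
    of sizes. *)
Lemma slice_boundS N : macaulay_borel_in N -> slice_bound_in N.
Proof.
case: N => [_ [|t] A L bA sL|N mac t A L bA sL].
- by rewrite !mons1.
- by [].
apply: contraTT; rewrite -!ltnNge => lt0.
(* [C j] is the lex segment as large as the slice [A_j]; multiplication by the last
   variable of the slice sends [C j.+1] into [C j]. *)
have exC j : exists C, lexseg_at N.+1 (t - j) C /\
    count C (mons N.+1 (t - j)) = count (fun w => A (rcons w j)) (mons N.+1 (t - j)).
  have [C sC eC] := lexseg_exists (count_size (fun w => A (rcons w j)) (mons N.+1 (t - j))).
  by exists C.
have step C j w x : j < t -> lexseg_at N.+1 (t - j.+1) C ->
    count C (mons N.+1 (t - j.+1)) = count (fun w => A (rcons w j.+1)) (mons N.+1 (t - j.+1)) ->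
    rcons w x \in mons N.+1 (t - j.+1) -> C (rcons w x) ->
  exists C', [/\ lexseg_at N.+1 (t - j) C',
    count C' (mons N.+1 (t - j)) = count (fun w => A (rcons w j)) (mons N.+1 (t - j)) & C' (rcons w x.+1)].
  move=> jt sC cC wm Cw; have [C' [sC' cC']] := exC j.
  exists C'; split=> //; apply: (@lexseg_nested N.+1 (t - j) (shadow C) C') => //.
  - by rewrite -(subnSK jt); apply: lexseg_shadow.
  - rewrite cC'; apply: (@leq_trans (count (shadow (fun w => A (rcons w j.+1))) (mons N.+1 (t - j)))).
      by rewrite -(subnSK jt); apply: mac => //; [apply: borel_rcons|rewrite cC].
    by apply: leq_count; apply: borel_shadow_slice.
  - by rewrite -(subnSK jt) -cats1 dec_mons cats1.
  - by rewrite shadow_rcons Cw orbT.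
have down j : j <= t -> forall C w x, lexseg_at N.+1 (t - j) C ->
    count C (mons N.+1 (t - j)) = count (fun w => A (rcons w j)) (mons N.+1 (t - j)) ->
    rcons w x \in mons N.+1 (t - j) -> C (rcons w x) ->
  exists C', [/\ lexseg_at N.+1 t C',
    count C' (mons N.+1 t) = count (fun w => A (rcons w 0)) (mons N.+1 t) & C' (rcons w (x + j))].
  elim: j => [|j IHj] jt C w x sC cC wm Cw.
    by exists C; move: sC cC; rewrite subn0 addn0.
  have [C' [s1 c1 h1]] := step C j w x jt sC cC wm Cw.
  rewrite -addSnnS; apply: IHj h1 => //; first exact: ltnW.
  by rewrite -(subnSK jt) -cats1 dec_mons cats1.
have sub j : j <= t -> count (fun w => A (rcons w j)) (mons N.+1 (t - j)) <=
    count (fun w => L (rcons w j)) (mons N.+1 (t - j)).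
  move=> jt; have [C [sC cC]] := exC j; rewrite -cC; apply: leq_count => m.
  case/lastP: m => [|w x wm Cw]; first by rewrite mem_mons.
  have [C0 [s0 c0 h0]] := down j jt C w x sC cC wm Cw.
  have m0 : rcons w (x + j) \in mons N.+1 t.
    by move: wm; rewrite !mem_mons !size_rcons !sumn_rcons => /andP[-> /eqP e] /=; lia.
  (* [C0] is smaller than the slice of [L] at 0, so some [u] in that slice lies strictly below
     [rcons w (x + j)]. Having the same degree, the two differ before their last entry, so moving
     [j] back to the slice variable keeps the comparison. *)
  have hC0 : has (fun w => L (rcons w 0) && ~~ C0 w) (mons N.+1 t).
    apply: contraTT lt0 => /hasPn no; rewrite -leqNgt -c0; apply: leq_count => u um Lu.
    by have := no u um; rewrite Lu /= negbK.
  case/hasP: hC0 => u um /andP[Lu nu].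
  have lu : lexge (rcons w (x + j)) u.
    by case/orP: (lexge_total (rcons w (x + j)) u) => // h; rewrite (s0 u _ um m0 h h0) in nu.
  apply: sL Lu; [by rewrite mons_rcons|by rewrite mons_rcons ?subn0|].
  case/lastP: u um nu lu => [|u y um nu]; first by rewrite mem_mons.
  have suw : size w = size u by move: (size_mem_mons um) (size_mem_mons m0); rewrite !size_rcons => -[->] [->].
    rewrite !lexge_rcons ?size_rcons ?suw // => /andP[-> /=].
  case: eqP => [wu _ |_ _]; last by case: eqP => // /rcons_inj[].
  have xy : x + j = y by move: (sumn_mem_mons um) (sumn_mem_mons m0); rewrite !sumn_rcons wu; lia.
  by move: nu; rewrite -xy -wu h0.
rewrite (count_mons_rcons A) (count_mons_rcons L).
by apply: (@ltn_sum_ord _ _ _ ord0) => [j|] /=; [apply: sub; rewrite -ltnS|rewrite subn0].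
Qed.

(** The two summands of [count_shadow_borel] are compared separately: one by the hypothesis on
    sizes, the other by induction once the slices are compared. *)
Theorem macaulay_borel N : macaulay_borel_in N.
Proof.
elim: N => [|N IH] t A L bA sL c; first by [].
rewrite (count_shadow_borel bA) (count_shadow_borel (lexseg_borel sL)) leq_add //.
have b0 := borel_rcons (leq0n t) bA; have s0 := lexseg_rcons (leq0n t) sL.
by rewrite subn0 in b0 s0; apply: (IH) => //; apply: (slice_boundS IH bA sL c).
Qed.

Lemma slice_bound N : slice_bound_in N.
Proof. exact/slice_boundS/macaulay_borel. Qed.

Lemma mons2P m t : m \in mons 2 t -> exists x y, m = [:: x; y] /\ x + y = t.
Proof. by rewrite mem_mons; case: m => [|x [|y [|? ?]]] //= /eqP <-; exists x, y; rewrite addn0. Qed.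

(** Minimal growth passes to the monomials free of the last variable, which allows induction down to
    two variables. There a Borel set is a lex segment, hence determined by its size. *)
Lemma borel_head N t A L k : borel_at N.+2 t A -> lexseg_at N.+2 t L ->
  count L (mons N.+2 t) = count A (mons N.+2 t) ->
  count (shadow A) (mons N.+2 t.+1) <= count (shadow L) (mons N.+2 t.+1) ->
  {in mons N.+2 t, forall m, L m -> k <= head 0 m} ->
  {in mons N.+2 t, forall m, A m -> k <= head 0 m}.
Proof.
elim: N t A L => [|N IH] t A L bA sL c cs hL.
  move=> m mm Am; rewrite leqNgt; apply/negP => hk.
  have LA : {in mons 2 t, forall u, L u -> A u}.
    move=> u um Lu; have := hL _ um Lu; apply: contraTT => nA; rewrite -ltnNge.
    apply: leq_ltn_trans hk; rewrite leqNgt; apply: contraNN nA => lt.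
    apply: bA Am => // i; case/mons2P: mm um lt => h [x [-> <-]] /mons2P[g [y [-> e]]] /= lt.
    by case: i => [|[|[|i]]] //=; lia.
  have := eq_count_sub LA (eq_leq (esym c)) mm; rewrite Am => Lm.
  by have := hL _ mm Lm; rewrite leqNgt hk.
have b0 := borel_rcons (leq0n t) bA; have s0 := lexseg_rcons (leq0n t) sL.
rewrite subn0 in b0 s0.
have c0 := slice_bound bA sL (eq_leq c).
have b00 := borel_rcons (leq0n t) b0; have s00 := lexseg_rcons (leq0n t) s0.
rewrite subn0 in b00 s00.
have c00 := slice_bound b0 s0 c0; have m00 := macaulay_borel b00 s00 c00.
move: cs; rewrite (count_shadow_borel bA) (count_shadow_borel (lexseg_borel sL)) c leq_add2r => cs.
(* Splitting a second time and using [m00] shows that the two slices at 0 have equal size, as the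
   induction hypothesis requires. *)
have cs' := cs; move: cs'; rewrite (count_shadow_borel b0) (count_shadow_borel (lexseg_borel s0)) => cs'.
have hA : {in mons N.+2 t, forall m, A (rcons m 0) -> k <= head 0 m}.
  apply: IH b0 s0 _ cs _; first by lia.
  move=> [|h m] mm Lm; first by move: mm; rewrite mem_mons.
  by have := hL _ _ Lm; rewrite /= => -> //; rewrite -rcons_cons mons_rcons ?subn0.
move=> m; case/lastP: m => [|w x]; first by rewrite mem_mons.
case/lastP: w => [|w y] mm Am; first by move: mm; rewrite mem_mons.
(* The whole power of the last variable is moved to the preceding one, a Borel move that leaves the
   first exponent unchanged. *)
have wm : rcons w (y + x) \in mons N.+2 t.
  by move: mm; rewrite !mem_mons !size_rcons !sumn_rcons !eqSS => /andP[-> /eqP e] /=; lia.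
have := hA _ wm; case: w mm Am wm => [|h w] mm Am wm; first by move: mm; rewrite mem_mons.
apply; apply: bA Am => //; first by rewrite mons_rcons ?subn0.
apply: dominates_rcons; first by rewrite !size_rcons.
  by apply: dominates_rcons => //; rewrite leq_add2l leq_addr.
by rewrite !sumn_rcons addn0 addnA.
Qed.

(** * Compression *)

(** Takes the unit to be carried to the entry in front of [v]. Taken from the first nonzero place,
    it lowers every positive partial sum by exactly one, so domination from above survives the
    move. *)
Fixpoint pop (v : seq nat) : seq nat :=
  match v with
  | 0 :: v' => 0 :: pop v'
  | x.+1 :: v' => x :: v'
  | [::] => [::]
  end.

Lemma size_pop v : size (pop v) = size v.
Proof. by elim: v => // -[|x] v //= ->. Qed.

Lemma sumn_take_pop v i : sumn (take i (pop v)) = (sumn (take i v)).-1.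
Proof. by elim: v i => // -[|x] v IH [|i] //=; rewrite !add0n IH. Qed.

Lemma sumn_pop v : sumn (pop v) = (sumn v).-1.
Proof. by rewrite -(take_size (pop v)) sumn_take_pop size_pop take_size. Qed.

(** * Dominance is generated by adjacent moves *)

Section AdjacentMoves.
Variables (N t : nat) (A : pred (seq nat)).
Hypothesis adj : forall p x y q, p ++ x :: y.+1 :: q \in mons N t ->
  A (p ++ x :: y.+1 :: q) -> A (p ++ x.+1 :: y :: q).

Lemma pop_move p x v : 0 < sumn v -> p ++ x :: v \in mons N t ->
  A (p ++ x :: v) -> A (p ++ x.+1 :: pop v).
Proof.
elim: v p x => // -[|y] v IH p x /=; last by move=> _; apply: adj.
rewrite add0n => v0 mm Am.
have := IH (rcons p x) 0 v0; rewrite !cat_rcons => /(_ mm Am).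
apply: adj; move: mm; rewrite !mem_mons !size_cat !sumn_cat /= size_pop sumn_pop => /andP[-> /eqP e] /=; lia.
Qed.

(** While the first entry of [v] is too small, a unit is popped into it from the tail, by an inner
    induction on the gap [x - y]; once the first entries agree they join the fixed prefix [p]. *)
Lemma adjacent_dominates n p u v : size u = n -> size v = n -> sumn u = sumn v -> dominates u v ->
  p ++ v \in mons N t -> A (p ++ v) -> A (p ++ u).
Proof.
elim: n p u v => [|n IH] p u v; first by move=> /size0nil -> /size0nil ->.
case: u => // x u; case: v => // y v [su] [sv].
move: {2}(x - y) (leqnn (x - y)) => k; elim: k y v sv => [|k IHk] y v sv xy e d.
  have yx : y = x by have := d 1; rewrite /= !take0; lia.
  rewrite yx -!cat_rcons => mm Am; apply: IH Am => //; first by move: e => /=; lia.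
  by apply: (@dominates_cons_inv _ _ x); move: d; rewrite yx.
have := d 1; rewrite /= !take0 /= !addn0 leq_eqVlt => /predU1P[yx|yx].
  rewrite yx -!cat_rcons => mm Am; apply: IH Am => //; first by move: e => /=; lia.
  by apply: (@dominates_cons_inv _ _ x); move: d; rewrite yx.
move=> mm Am; move: e; rewrite /= => e.
have v0 : 0 < sumn v by lia.
apply: (IHk y.+1 (pop v)); rewrite ?size_pop //=; first by lia.
- by rewrite sumn_pop; lia.
- move=> [|i] //=; rewrite sumn_take_pop; have := d i.+1; rewrite /=.
  by have := leq0n (sumn (take i u)); lia.
- by move: mm; rewrite !mem_mons !size_cat !sumn_cat /= size_pop sumn_pop => /andP[-> /eqP ?] /=; lia.
- exact: pop_move.
Qed.

Lemma adjacent_borel : borel_at N t A.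
Proof.
move=> u v um vm d Av; apply: (@adjacent_dominates N [::] u v) => //;
  rewrite ?(size_mem_mons um) ?(size_mem_mons vm) //.
by rewrite (sumn_mem_mons um) (sumn_mem_mons vm).
Qed.
End AdjacentMoves.

Lemma big_mons2 (F : seq nat -> nat) d :
  \sum_(w <- mons 2 d) F w = \sum_(s < d.+1) F [:: d - s; s : nat].
Proof. by rewrite big_mons_rcons; apply: eq_bigr => s _; rewrite mons1 big_seq1. Qed.

Lemma count_mons2 f d : count f (mons 2 d) = \sum_(s < d.+1) f [:: d - s; s : nat].
Proof. by rewrite count_sum big_mons2. Qed.

(** Each exponent [s] in the set puts [s] and [s.+1] into the shadow. Without growth the set would
    be closed under successor, although it is bounded by [d]. *)
Lemma count_shad2 f d : 0 < count f (mons 2 d) -> count f (mons 2 d) < count (shadow f) (mons 2 d.+1).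
Proof.
rewrite !count_mons2; pose F s := (s <= d) && f [:: d - s; s].
have -> : \sum_(s < d.+1) (f [:: d - s; s : nat] : nat) = \sum_(s < d.+2) (F s : nat).
  rewrite [RHS]big_ord_recr /= /F ltnn addn0; apply: eq_bigr => s _.
  by rewrite -ltnS ltn_ord.
have FS s : F s -> s < d.+2 -> shadow f [:: d.+1 - s; s] && shadow f [:: d.+1 - s.+1; s.+1].
  rewrite /F => /andP[sd fs] _; rewrite /= subSS fs !orbT andbT.
  by rewrite subn_gt0 ltnS sd -subnS subSS fs.
move=> pos; rewrite ltnNge; apply/negP => le.
have nlt (s : 'I_d.+2) : ~~ ((F s : nat) < (shadow f [:: d.+1 - s; s : nat] : nat)).
  apply: contraTN le => lt; rewrite -ltnNge; apply: ltn_sum_ord lt => j.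
  by case Fj : (F j) => //; case/andP: (FS j Fj (ltn_ord j)) => -> _.
have up s : F s -> F s.+1.
  move=> Fs; have sd : s <= d by case/andP: Fs.
  have /andP[_ h] := FS s Fs (leqW sd).
  by have := nlt (Ordinal (sd : s.+1 < d.+2)); rewrite [val _]/= h; case: (F s.+1).
have all s k : F s -> F (s + k) by move=> Fs; elim: k => [|k IH]; rewrite ?addn0 // addnS up.
move: pos; rewrite lt0n sum_nat_eq0 negb_forall => /existsP[s]; rewrite implyTb eqb0 negbK.
by move=> /(all _ d.+1) /andP[]; rewrite addnS ltnNge leq_addl.
Qed.

(* Two-variable compression in the variables [p] and [p.+1]: in each family of monomials that
   differ only there, keep the number of elements but take those with the smallest exponent at
   [p.+1]. *)
Definition compress p (A : pred (seq nat)) : pred (seq nat) := fun m =>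
  nth 0 m p.+1 < count (fun w => A (take p m ++ w ++ drop p.+2 m)) (mons 2 (nth 0 m p + nth 0 m p.+1)).

Lemma compressE p A u x y v : size u = p ->
  compress p A (u ++ [:: x; y] ++ v) = (y < count (fun w => A (u ++ w ++ v)) (mons 2 (x + y))).
Proof.
move=> <-; rewrite /compress take_size_cat // -(add2n (size u)) -drop_drop drop_size_cat //.
have n0 : nth 0 (u ++ [:: x; y] ++ v) (size u) = x by rewrite nth_cat ltnn subnn.
have n1 : nth 0 (u ++ [:: x; y] ++ v) (size u).+1 = y by rewrite nth_cat -(addn1 (size u)) ltnNge leq_addr addKn.
by rewrite n0 n1 /= drop0.
Qed.

Lemma big_mons_cat3 (F : seq nat -> nat) p q t :
  \sum_(m <- mons (p + (2 + q)) t) F m =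
  \sum_(s < t.+1) \sum_(u <- mons p s) \sum_(d < (t - s).+1) \sum_(v <- mons q (t - s - d))
    \sum_(w <- mons 2 d) F (u ++ w ++ v).
Proof.
rewrite big_mons_cat; apply: eq_bigr => s _; apply: eq_bigr => u _.
by rewrite big_mons_cat; apply: eq_bigr => d _; rewrite exchange_big.
Qed.

Lemma compress_slice p A u v d : size u = p ->
  {in mons 2 d, forall w, compress p A (u ++ w ++ v) =
     (nth 0 w 1 < count (fun w' => A (u ++ w' ++ v)) (mons 2 d))}.
Proof. by move=> su w /mons2P[x [y [-> <-]]]; rewrite compressE. Qed.

Lemma sum_ltn_ord k n : k <= n -> \sum_(s < n) (s < k : nat) = k.
Proof.
elim: n k => [|n IH] k; first by rewrite leqn0 big_ord0 => /eqP->.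
rewrite leq_eqVlt => /predU1P[->|]; last first.
  by rewrite ltnS big_ord_recr /= => kn; rewrite IH // ltnNge kn addn0.
by under eq_bigr => s _ do rewrite ltn_ord; rewrite sum1_card card_ord.
Qed.

Lemma count_mons2_ltn k d : k <= d.+1 -> count (fun w => nth 0 w 1 < k) (mons 2 d) = k.
Proof. by move=> kd; rewrite count_mons2 /= sum_ltn_ord. Qed.

Lemma count_mons2_le f d : count f (mons 2 d) <= d.+1.
Proof. by rewrite (leq_trans (count_size _ _)) // size_mons bin1 addn1. Qed.

Lemma count_compress p q A t :
  count (compress p A) (mons (p + (2 + q)) t) = count A (mons (p + (2 + q)) t).
Proof.
rewrite !count_sum !big_mons_cat3; apply: eq_bigr => s _; apply: eq_big_seq => u /size_mem_mons su.
apply: eq_bigr => d _; apply: eq_bigr => v _; rewrite -!count_sum.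
by rewrite (eq_in_count (compress_slice A v su)) count_mons2_ltn ?count_mons2_le.
Qed.

Lemma shadow_cat A u v : shadow A (u ++ v) = shadow (fun w => A (w ++ v)) u || shadow (fun w => A (u ++ w)) v.
Proof. by elim: u A => [|x u IH] A //=; rewrite IH orbA. Qed.

(** The extra factor lies before, in or after the compressed pair. In the outer cases the slice of
    the shadow contains a slice of [A]. In the middle case an initial segment of size [k] has a
    shadow of size [k.+1], which [count_shad2] provides for any nonempty slice. *)
Lemma shadow_compress p q A t :
  {in mons (p + (2 + q)) t, forall m, shadow (compress p A) m -> compress p (shadow A) m}.
Proof.
move=> m mm; rewrite -(cat_take_drop p m).
have su : size (take p m) = p by rewrite size_takel // (size_mem_mons mm) leq_addr.
have : size (drop p m) = 2 + q by rewrite size_drop (size_mem_mons mm) addKn.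
move: (take p m) (drop p m) su => u; case=> [|x [|y v]] // su _ {m mm}.
rewrite -[_ :: _]/([:: x; y] ++ v) compressE // !shadow_cat.
have sub3 w : shadow (fun w => A (u ++ w)) (w ++ v) -> shadow A (u ++ w ++ v).
  by move=> h; rewrite shadow_cat h orbT.
case/or3P.
- move=> /shadowP[a [z [b [eu]]]]; rewrite compressE; last by rewrite -su eu !size_cat.
  move=> h; apply: leq_trans h _; apply: leq_count => w _ Aw.
  by rewrite shadow_cat eu; apply/orP; left; apply/shadowP; exists a, z, b.
- rewrite /= orbF => h.
  have [d [k0 ed]] : exists d, 0 < count (fun w => A (u ++ w ++ v)) (mons 2 d) /\
      (x + y = d.+1 /\ y <= count (fun w => A (u ++ w ++ v)) (mons 2 d)).
    case/orP: h => /andP[].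
      case: x => // x _; rewrite -[u ++ _]/(u ++ [:: x; y] ++ v) compressE // => h.
      by exists (x + y); split; [exact: leq_ltn_trans h|split; [rewrite addSn|exact: ltnW]].
    case: y => // y _; rewrite -[u ++ _]/(u ++ [:: x; y] ++ v) compressE // => h.
    by exists (x + y); split; [exact: leq_ltn_trans h|split; [rewrite addnS|]].
  case: ed => -> le; apply: leq_ltn_trans le (leq_trans (count_shad2 k0) _).
  by apply: leq_count => w _ h'; apply: sub3; rewrite shadow_cat h'.
- move=> /shadowP[a [z [b [ev]]]]; rewrite compressE // => h; apply: leq_trans h _.
  apply: leq_count => w _ Aw; rewrite !shadow_cat; apply/or3P; apply: Or33.
  by apply/shadowP; exists a, z, b.
Qed.

(* Equals the sum of [i * m_i]; it decreases in every nontrivial compression, so compressing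
   terminates. *)
Fixpoint wt (m : seq nat) : nat := if m is x :: m' then sumn m' + wt m' else 0.

Lemma wt_cat u w : wt (u ++ w) = wt u + size u * sumn w + wt w.
Proof. by elim: u => [|x u IH] //=; rewrite IH sumn_cat mulSn; lia. Qed.

(* The smallest possible sum of [k] distinct natural numbers. *)
Fixpoint tri k := if k is k'.+1 then tri k' + k' else 0.

Lemma sum_ltn_tri k n : k <= n -> \sum_(s < n) (s < k) * s = tri k.
Proof.
elim: n k => [|n IH] k; first by rewrite leqn0 big_ord0 => /eqP->.
rewrite leq_eqVlt => /predU1P[->|]; last first.
  by rewrite ltnS big_ord_recr /= => kn; rewrite IH // ltnNge kn addn0.
rewrite big_ord_recr /= ltnSn mul1n -(IH n) //; congr (_ + _).
by apply: eq_bigr => s _; rewrite ltn_ord ltnS ltnW.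
Qed.

Lemma sum_bool_leq (F : nat -> bool) n : \sum_(s < n) F s <= n.
Proof. by rewrite -[leqRHS]card_ord -sum1_card; apply: leq_sum => s _; apply: leq_b1. Qed.

Lemma tri_leq (F : nat -> bool) n : tri (\sum_(s < n) F s) <= \sum_(s < n) F s * s.
Proof.
elim: n => [|n IH]; first by rewrite !big_ord0.
rewrite !big_ord_recr /=; case: (F n); rewrite ?addn0 // addn1 mul1n /= leq_add //.
exact: sum_bool_leq.
Qed.

Lemma tri_ltn (F : nat -> bool) n s : s.+1 < n -> ~~ F s -> F s.+1 ->
  tri (\sum_(s < n) F s) < \sum_(s < n) F s * s.
Proof.
elim: n => // n IH; rewrite ltnS leq_eqVlt => /predU1P[<-|sn] nF FS.
  rewrite !big_ord_recr /= (negbTE nF) FS /= !addn0 addn1 mul1n /= -addnS leq_add ?tri_leq // ltnS.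
  exact: sum_bool_leq.
have lt := IH sn nF FS.
rewrite !big_ord_recr /=; case: (F n); rewrite ?addn0 // addn1 mul1n /= -addSn leq_add //.
exact: sum_bool_leq.
Qed.

Lemma slice_weight (f : pred (seq nat)) c d : \sum_(w <- mons 2 d) f w * (c + nth 0 w 1) =
  c * count f (mons 2 d) + \sum_(s < d.+1) f [:: d - s; s : nat] * s.
Proof.
rewrite count_sum !big_mons2 big_distrr -big_split /=; apply: eq_bigr => s _.
by rewrite mulnDr mulnC.
Qed.

Lemma compressed_weight f c d :
  \sum_(w <- mons 2 d) (nth 0 w 1 < count f (mons 2 d)) * (c + nth 0 w 1) =
  c * count f (mons 2 d) + tri (count f (mons 2 d)).
Proof.
by rewrite (slice_weight (fun w => nth 0 w 1 < _)) count_mons2_ltn ?sum_ltn_tri // count_mons2_le.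
Qed.

(** Within a slice only the split of [d] between the two variables varies, so [wt] is a constant
    plus the second exponent; minimizing the weight means choosing the smallest second exponents. *)
Lemma wt_slice u w v d : w \in mons 2 d ->
  wt (u ++ w ++ v) = wt u + size u * (d + sumn v) + (2 * sumn v + wt v) + nth 0 w 1.
Proof. by case/mons2P=> x [y [-> <-]]; rewrite wt_cat sumn_cat /=; lia. Qed.

Definition weight N t (A : pred (seq nat)) := \sum_(m <- mons N t) A m * wt m.

Lemma compress_slice_weight p A u v d : size u = p ->
  \sum_(w <- mons 2 d) compress p A (u ++ w ++ v) * wt (u ++ w ++ v)
  <= \sum_(w <- mons 2 d) A (u ++ w ++ v) * wt (u ++ w ++ v).
Proof.
move=> su; pose c := wt u + size u * (d + sumn v) + (2 * sumn v + wt v).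
rewrite (eq_big_seq (fun w =>
  (nth 0 w 1 < count (fun w => A (u ++ w ++ v)) (mons 2 d)) * (c + nth 0 w 1))); last first.
  by move=> w wm /=; rewrite (wt_slice u v wm) (compress_slice A v su wm).
rewrite [leqRHS](eq_big_seq (fun w => A (u ++ w ++ v) * (c + nth 0 w 1))); last first.
  by move=> w wm /=; rewrite (wt_slice u v wm).
rewrite compressed_weight (slice_weight (fun w => A (u ++ w ++ v))) leq_add2l count_mons2.
exact: (tri_leq (fun s => A (u ++ [:: d - s; s] ++ v))).
Qed.

Lemma compress_slice_weight_lt p (A : pred (seq nat)) u v x y : size u = p ->
  A (u ++ [:: x; y.+1] ++ v) -> ~~ A (u ++ [:: x.+1; y] ++ v) ->
  \sum_(w <- mons 2 (x + y.+1)) compress p A (u ++ w ++ v) * wt (u ++ w ++ v)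
  < \sum_(w <- mons 2 (x + y.+1)) A (u ++ w ++ v) * wt (u ++ w ++ v).
Proof.
move=> su Ay nA; set d := x + y.+1; pose c := wt u + size u * (d + sumn v) + (2 * sumn v + wt v).
rewrite (eq_big_seq (fun w =>
  (nth 0 w 1 < count (fun w => A (u ++ w ++ v)) (mons 2 d)) * (c + nth 0 w 1))); last first.
  by move=> w wm /=; rewrite (wt_slice u v wm) (compress_slice A v su wm).
rewrite [ltnRHS](eq_big_seq (fun w => A (u ++ w ++ v) * (c + nth 0 w 1))); last first.
  by move=> w wm /=; rewrite (wt_slice u v wm).
rewrite compressed_weight (slice_weight (fun w => A (u ++ w ++ v))) ltn_add2l count_mons2.
have e1 : d - y = x.+1 by rewrite /d; lia.
have e2 : d - y.+1 = x by rewrite /d; lia.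
apply: (@tri_ltn (fun s => A (u ++ [:: d - s; s] ++ v)) _ y); rewrite ?e1 ?e2 //.
by rewrite /d; lia.
Qed.

Lemma weight_compress_lt p q (A : pred (seq nat)) t u x y v : size u = p -> size v = q ->
  u ++ x :: y.+1 :: v \in mons (p + (2 + q)) t ->
  A (u ++ x :: y.+1 :: v) -> ~~ A (u ++ x.+1 :: y :: v) ->
  weight (p + (2 + q)) t (compress p A) < weight (p + (2 + q)) t A.
Proof.
move=> su sv mm Am nA; rewrite /weight !big_mons_cat3.
have e : sumn u + (x + y.+1 + sumn v) = t.
  by have := sumn_mem_mons mm; rewrite sumn_cat /=; lia.
have hs : sumn u < t.+1 by lia.
have hd : x + y.+1 < (t - sumn u).+1 by lia.
apply: (@ltn_sum_ord _ _ _ (Ordinal hs)) => [s|] /=.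
  apply: leq_sum_seq => w /size_mem_mons sw; apply: leq_sum => d _; apply: leq_sum => z _.
  exact: compress_slice_weight.
apply: (@ltn_sum_seq _ _ _ _ u); last 1 first.
- apply: (@ltn_sum_ord _ _ _ (Ordinal hd)) => [d|] /=.
    by apply: leq_sum => z _; apply: compress_slice_weight.
  apply: (@ltn_sum_seq _ _ _ _ v).
  + by move=> z _; apply: compress_slice_weight.
  + by rewrite mem_mons sv eqxx /=; lia.
  + exact: compress_slice_weight_lt.
- move=> w /size_mem_mons sw; apply: leq_sum => d _; apply: leq_sum => z _.
  exact: compress_slice_weight.
- by rewrite mem_mons su !eqxx.
Qed.

Definition adj_move p (m : seq nat) := take p m ++ (nth 0 m p).+1 :: (nth 0 m p.+1).-1 :: drop p.+2 m.

Lemma adj_moveE p x y q : adj_move (size p) (p ++ x :: y.+1 :: q) = p ++ x.+1 :: y :: q.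
Proof.
rewrite /adj_move take_size_cat // -(add2n (size p)) -drop_drop drop_size_cat //= drop0.
by rewrite !nth_cat ltnn subnn -(addn1 (size p)) ltnNge leq_addr addKn.
Qed.

(** Induction on [weight]: as long as an adjacent move leads out of [A], compression in that pair of
    variables keeps the size, does not enlarge the shadow and lowers the weight. When no such move
    is left, [A] is Borel. *)
Lemma borel_compression N t (A : pred (seq nat)) : exists B, [/\ borel_at N t B,
  count B (mons N t) = count A (mons N t) &
  count (shadow B) (mons N t.+1) <= count (shadow A) (mons N t.+1)].
Proof.
have [n] := ubnP (weight N t A); elim: n A => // n IH A /ltnSE wA.
pose bad m p := [&& A m, p.+1 < N, 0 < nth 0 m p.+1 & ~~ A (adj_move p m)].
have [|ok] := boolP (has (fun m => has (bad m) (iota 0 N)) (mons N t)); last first.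
  exists A; split=> //; apply: adjacent_borel => p x y q mm Am.
  apply: contraNT ok => nA; apply/hasP; exists (p ++ x :: y.+1 :: q) => //.
  have sN := size_mem_mons mm; rewrite size_cat /= in sN.
  apply/hasP; exists (size p); first by rewrite mem_iota -sN; lia.
  have ny : nth 0 (p ++ x :: y.+1 :: q) (size p).+1 = y.+1.
    by rewrite nth_cat -(addn1 (size p)) ltnNge leq_addr addKn.
  by rewrite /bad adj_moveE Am nA ny -sN; lia.
case/hasP=> m mm /hasP[p _ /and4P[Am pN y0 nA]].
pose q := N - p.+2; have eN : N = p + (2 + q) by rewrite /q; lia.
have sm := size_mem_mons mm.
pose u := take p m; pose v := drop p.+2 m; pose x := nth 0 m p; pose y := (nth 0 m p.+1).-1.
have su : size u = p by rewrite /u size_takel // sm; lia.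
have em : m = u ++ x :: y.+1 :: v.
  by rewrite /y prednK // /v -drop_nth ?sm // -drop_nth ?cat_take_drop // sm; lia.
have lt : weight N t (compress p A) < weight N t A.
  move: mm Am nA; rewrite em -su adj_moveE su eN; apply: weight_compress_lt => //.
  by rewrite /v size_drop sm eN; lia.
have [B [bB cB sB]] := IH (compress p A) (leq_trans lt wA).
exists B; split=> //; first by rewrite cB eN count_compress.
apply: leq_trans sB _; rewrite eN -(count_compress p q (shadow A)); apply: leq_count.
exact: shadow_compress.
Qed.

Theorem macaulay N t A L : lexseg_at N t L -> count L (mons N t) <= count A (mons N t) ->
  count (shadow L) (mons N t.+1) <= count (shadow A) (mons N t.+1).
Proof.
move=> sL c; have [B [bB cB sB]] := borel_compression N t A.
by apply: leq_trans sB; apply: macaulay_borel => //; rewrite cB.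
Qed.

(** * Saturated lexicographic ideals *)

(* The saturated lexicographic ideal with Gotzmann numbers [b] in [n.+1] variables is
   [lexge^~ (mult_vec n b)]: entry [i] counts the [b_j] equal to [n - 1 - i], and the last
   variable is not compared. *)
Fixpoint mult_vec (n : nat) (b : seq nat) : seq nat :=
  if n is n'.+1 then count_mem n' b :: mult_vec n' b else [::].

Lemma size_mult_vec n b : size (mult_vec n b) = n.
Proof. by elim: n => //= n ->. Qed.

Lemma eq_mult_vec n b b' : (forall i, i < n -> count_mem i b = count_mem i b') -> mult_vec n b = mult_vec n b'.
Proof.
elim: n => //= n IH h; rewrite h // IH // => i le; apply: h; exact: leqW.
Qed.

Lemma last_mult_vec n b x : last x (mult_vec n.+1 b) = count_mem 0 b.
Proof. by elim: n x => //= n IH x; rewrite IH. Qed.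

Lemma sorted_geq_split n b : sorted geq b -> all (fun x => x < n.+1) b ->
  b = nseq (count_mem n b) n ++ [seq x <- b | x < n].
Proof.
elim: b => //= x b IH sb /andP[xn bn].
have := IH (path_sorted sb) bn; move: xn; rewrite ltnS leq_eqVlt => /predU1P[->|xn].
  by rewrite eqxx ltnn /= => e; rewrite -e.
have hb : all (fun y => y < n) b.
  have : all (geq x) b by move: sb; rewrite path_sortedE; [case/andP|exact: (rev_trans leq_trans)].
  by apply: sub_all => y yx; apply: leq_ltn_trans xn.
rewrite xn (ltn_eqF xn) /= (_ : count_mem n b = 0) /= => [<- //|].
by apply/count_memPn/negP => nb; have := allP hb n nb; rewrite ltnn.
Qed.

Lemma sumn_mult_vec n b : all (fun x => x < n) b -> sumn (mult_vec n b) = size b.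
Proof.
elim: n b => [|n IH] b; first by case: b => //= x b /andP[].
move=> hb /=; have e : mult_vec n b = mult_vec n [seq x <- b | x < n].
  apply: eq_mult_vec => i le; rewrite count_filter; apply: eq_count => x /=.
  by case: eqP => // ->.
rewrite e IH ?filter_all // size_filter -(count_predC (pred1 n)); congr (_ + _).
apply: eq_in_count => x xb /=; have := allP hb x xb.
by rewrite ltnS leq_eqVlt; case: ltngtP.
Qed.

(** Slice by the first exponent [s], with [k] the first entry of [mult_vec]: for [s < k] the whole
    slice is in the complement and gives one binomial, for [s = k] the recursion takes over in
    degree [t - k], and for [s > k] nothing is left. The bound on [size b] keeps the subtractions
    from truncating. *)
Lemma count_lex_compl n b t : sorted geq b -> all (fun x => x < n) b -> size b <= t ->
  count (fun m => ~~ lexge m (mult_vec n b)) (mons n.+1 t) =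
  \sum_(j < size b) 'C(t + nth 0 b j - j, nth 0 b j).
Proof.
elim: n b t => [|n IH] b t sb hb bt.
  case: b sb hb bt => [|x b] _ //= _ _.
  by rewrite big_ord0; apply/eqP; rewrite -leqn0 leqNgt -has_count; apply/hasPn => -[].
set k := count_mem n b; set b' := [seq x <- b | x < n].
have eb : b = nseq k n ++ b' := sorted_geq_split sb hb.
have sz : size b = k + size b' by rewrite {1}eb size_cat size_nseq.
have eA : mult_vec n b = mult_vec n b'.
  apply: eq_mult_vec => i le; rewrite count_filter; apply: eq_count => x /=.
  by case: eqP => // ->.
have kt : k <= t by rewrite (leq_trans _ bt) // sz leq_addr.
pose G s := count (fun w => ~~ lexge (s :: w) (mult_vec n.+1 b)) (mons n.+1 (t - s)).
rewrite count_mons_cons -(big_mkord xpredT G) (big_cat_nat (n := k)) //=; last exact: leqW.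
have -> : \sum_(k <= s < t.+1) G s = G k.
  rewrite big_ltn ?ltnS // big_nat big1 ?addn0 // => s /andP[ks _].
  apply/eqP; rewrite -leqn0 leqNgt -has_count.
  by apply/hasPn => w _ /=; rewrite negbK -/k ks.
have -> : G k = \sum_(j < size b') 'C((t - k) + nth 0 b' j - j, nth 0 b' j).
  rewrite -IH ?filter_all //; last by rewrite leq_subRL // -sz.
    by apply: eq_count => w /=; rewrite -/k ltnn eqxx eA.
  by apply: sorted_filter => //; exact: (rev_trans leq_trans).
rewrite sz big_split_ord /= big_mkord; congr (_ + _); apply: eq_bigr => j _.
  rewrite /G (_ : count _ _ = size (mons n.+1 (t - j))); last first.
    rewrite -count_predT; apply: eq_count => w /=.
    by rewrite -/k ltnNge ltnW //= (ltn_eqF (ltn_ord j)).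
  by rewrite size_mons eb nth_cat size_nseq ltn_ord nth_nseq ltn_ord addnBAC // ltnW // (leq_trans _ kt).
rewrite eb nth_cat size_nseq ltnNge leq_addr addKn subnDA; congr 'C(_ - _, _).
by rewrite addnBAC.
Qed.

(** * Borel ideals compared with lexicographic ideals *)

Definition borel_ideal N (A : pred (seq nat)) :=
  forall u v, size u = N -> size v = N -> dominates u v -> A v -> A u.

(** For a Borel ideal this is saturation; see [monos_of_last_free] and [monomial_span_saturated]. *)
Definition last_free n (A : pred (seq nat)) :=
  forall w x, size w = n -> A (rcons w x) = A (rcons w 0).

Lemma borel_ideal_at N t A : borel_ideal N A -> borel_at N t A.
Proof. by move=> bA u v /size_mem_mons su /size_mem_mons sv; apply: bA. Qed.

Lemma borel_ideal_shadow N A m : borel_ideal N A -> size m = N -> shadow A m -> A m.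
Proof.
move=> bA sm /shadowP[p [x [q [e Aq]]]]; apply: bA Aq => //; first by rewrite -sm e !size_cat.
move=> i; rewrite e !take_cat; case: ltnP => // _; rewrite !sumn_cat leq_add2l.
by case: (i - size p) => [|j] //=; rewrite leq_add2r.
Qed.

Lemma lexge_seg N t a : size a <= N -> lexseg_at N t (lexge^~ a).
Proof.
by move=> sa u v um vm uv /= va; apply: lexge_trans va => //; rewrite (size_mem_mons vm).
Qed.

Lemma lexge_borel N a : size a <= N -> borel_ideal N (lexge^~ a).
Proof. by move=> sa u v su sv d; apply: lexge_trans (dominates_lexge d); rewrite sv. Qed.

(** The lexicographic ideal has no generator of degree above [sumn a]: some exponent of [m] can be
    lowered, by the same case analysis as in [lexge_dec]. *)
Lemma lexge_shadow a m : size a <= size m -> sumn a < sumn m -> lexge m a -> shadow (lexge^~ a) m.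
Proof.
elim: a m => [|y a IH] [|x m] //=.
  move=> _ h _; apply/(shadowP (lexge^~ [::]) (x :: m)).
  by have [p [z [q ->]]] := @sumn_gt0P (x :: m) h; exists p, z, q; split=> //; case: (p ++ _).
rewrite ltnS => sz h /orP[yx|/andP[/eqP e ma]]; last first.
  have := IH m sz _ ma; rewrite -(ltn_add2l y) -{2}e => /(_ h) /shadowP[p [z [q [-> hz]]]].
  by apply/orP; right; apply/shadowP; exists p, z, q; rewrite e eqxx hz orbT.
have [m0|/sumn_gt0P[p [z [q ->]]]] := posnP (sumn m); last first.
  by apply/orP; right; apply/shadowP; exists p, z, q; rewrite yx.
apply/orP; left; case: x yx h => // x; rewrite ltnS leq_eqVlt /= => /predU1P[->|yx] h; last by rewrite yx.
by rewrite eqxx lexge_sum0 ?orbT //; lia.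
Qed.

Lemma lexge_head m a : m != [::] -> lexge m a -> head 0 a <= head 0 m.
Proof. by case: m a => [|x m] [|y a] //= _; case: ltngtP. Qed.

Lemma dominates_last w x y : x <= y -> dominates (rcons w y) (rcons w x).
Proof. by move=> xy; apply: dominates_rcons => //; rewrite leq_add2l. Qed.

(* If some degree violated the bound, the lex segment of that size would contain a monomial
   outside the lexicographic ideal; by Macaulay's theorem so would all its multiples by powers of
   the last variable, in degrees where the two sets have the same size. *)
Lemma lex_max_count n A a t0 : borel_ideal n.+1 A -> size a = n ->
  (forall t, t0 <= t -> count A (mons n.+1 t) = count (lexge^~ a) (mons n.+1 t)) ->
  forall s, count A (mons n.+1 s) <= count (lexge^~ a) (mons n.+1 s).
Proof.
move=> bA sa ct s; rewrite leqNgt; apply/negP => lt.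
have [S sS cS] := lexseg_exists (count_size A (mons n.+1 s)).
have : has (fun w => S w && ~~ lexge w a) (mons n.+1 s).
  apply: contraTT lt => /hasPn no; rewrite -leqNgt -cS; apply: leq_count => u um Su.
  by have := no u um; rewrite Su /= negbK.
case/hasP=> m; case/lastP: m => [|w x mm /andP[Sw]]; first by rewrite mem_mons.
have sw : size w = n by move: (size_mem_mons mm); rewrite size_rcons => -[].
rewrite lexge_rconsl ?sw ?sa // => /negP nw.
have [T [sT cT [mT hT]]] : exists T, [/\ lexseg_at n.+1 (s + t0) T,
    count T (mons n.+1 (s + t0)) <= count A (mons n.+1 (s + t0)) &
    rcons w (x + t0) \in mons n.+1 (s + t0) /\ T (rcons w (x + t0))].
  elim: (t0) => [|k [T [sT cT [mT hT]]]]; first by exists S; rewrite !addn0 cS; split.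
  exists (shadow T); rewrite !addnS; split; first exact: lexseg_shadow.
    apply: leq_trans (macaulay_borel (@borel_ideal_at _ _ _ bA) sT cT) _.
    by apply: leq_count => u /size_mem_mons su; apply: borel_ideal_shadow bA su.
  by rewrite shadow_rcons /= hT orbT -cats1 dec_mons cats1.
rewrite ct ?leq_addl // in cT.
have sa' : size a <= n.+1 by rewrite sa.
have := lexseg_nested sT (@lexge_seg n.+1 (s + t0) a sa') cT mT hT.
by rewrite /= lexge_rconsl ?sw ?sa.
Qed.

(** Multiplying by the last variable preserves the first exponent, so the bound may be tested in a
    large degree, where [borel_head] applies. *)
Lemma borel_head_bound N A a t0 : borel_ideal N.+2 A -> size a <= N.+2 ->
  (forall t, t0 <= t -> count A (mons N.+2 t) = count (lexge^~ a) (mons N.+2 t)) ->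
  forall m, size m = N.+2 -> A m -> head 0 a <= head 0 m.
Proof.
move=> bA sa ct m; case/lastP: m => // w x sm Am.
(* From [t0] on the counts agree, from [sumn a] on the lexicographic ideal grows by shadows, and the
   last term makes room for the given monomial. *)
pose T := maxn t0 (maxn (sumn a) (sumn (rcons w x))).
pose m := rcons w (x + (T - sumn (rcons w x))).
have sx : sumn w + x <= T by rewrite /T sumn_rcons; lia.
have mm : m \in mons N.+2 T.
  by rewrite mem_mons /m size_rcons -sm size_rcons eqxx !sumn_rcons; lia.
have Am' : A m.
  by apply: bA Am; rewrite ?(size_mem_mons mm) //; apply: dominates_last; apply: leq_addr.
have -> : head 0 (rcons w x) = head 0 m by rewrite /m; move: (x + _) => z; case: (w) sm.
apply: (@borel_head N T A (lexge^~ a)) Am' => //.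
- exact: borel_ideal_at.
- exact: lexge_seg.
- by rewrite ct // leq_maxl.
- apply: (@leq_trans (count A (mons N.+2 T.+1))).
    by apply: leq_count => u /size_mem_mons su; apply: borel_ideal_shadow bA su.
  rewrite ct; last by rewrite leqW // leq_maxl.
  apply: leq_count => u um ua; apply: lexge_shadow => //; first by rewrite (size_mem_mons um).
  by rewrite (sumn_mem_mons um) ltnS /T; lia.
- move=> u um /lexge_head; apply; apply/eqP => u0; by move: um; rewrite u0 mem_mons.
Qed.

Lemma sumn_nseq0 n : sumn (nseq n 0) = 0.
Proof. by elim: n. Qed.

Lemma dominates_big_head x u v : sumn v <= x -> dominates (x :: u) v.
Proof.
move=> h [|i] /=; first by rewrite take0.
apply: leq_trans (leq_trans _ h) (leq_addr _ _).
by rewrite -{2}(cat_take_drop i.+1 v) sumn_cat leq_addr.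
Qed.

(* Here the exponents of [a] exhaust the variables: the ideal has the Hilbert function of a
   lexicographic ideal with at most one generator per variable, and is peeled off variable by
   variable, starting with the largest one. *)
Lemma lex_unique_hilbert n A a : borel_ideal n A -> size a = n ->
  (forall s, count A (mons n s) = count (lexge^~ a) (mons n s)) ->
  forall m, size m = n -> A m = lexge m a.
Proof.
elim: n A a => [|n IH] A a bA sa ct m sm.
  have := ct 0; rewrite (size0nil sm) (size0nil sa) /=; by case: (A [::]).
case: a sa ct => // k a [sa] ct.
have hd u : size u = n.+1 -> A u -> k <= head 0 u.
  case: n {IH m sm} sa bA ct u => [|n] sa bA ct u su Au; last first.
    by apply: (@borel_head_bound n A (k :: a) 0) Au; rewrite //= sa.
  case: u su Au => [|x [|? ?]] // _ Ax; have := ct x; rewrite mons1 /= Ax.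
  by case: ltngtP.
(* The lexicographic ideal contains the power [k.+1] of the first variable, so [A] has some member
   of degree [k.+1], and every [u] with first exponent above [k] dominates it. *)
have top u : size u = n.+1 -> k < head 0 u -> A u.
  have c0 : 0 < count A (mons n.+1 k.+1).
    rewrite ct -has_count; apply/hasP; exists (k.+1 :: nseq n 0); last by rewrite /= ltnSn.
    by rewrite mem_mons /= size_nseq sumn_nseq0 addn0 !eqxx.
  move: c0; rewrite -has_count => /hasP[v vm Av]; case: u => //= x u su kx.
  apply: bA Av => //; first exact: size_mem_mons vm.
  by apply: dominates_big_head; rewrite (sumn_mem_mons vm).
(* By [hd] and [top] both sets have the same slices away from first exponent [k], so these
   cancel. *)
have slice s : count (fun w => A (k :: w)) (mons n s) = count (lexge^~ a) (mons n s).
  have := ct (k + s); rewrite !count_mons_cons.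
  have kl : k < (k + s).+1 by rewrite ltnS leq_addr.
  rewrite (bigD1 (Ordinal kl)) //= [RHS](bigD1 (Ordinal kl)) //= addKn.
  rewrite [X in _ + X = _](eq_bigr (fun i : 'I_(k + s).+1 =>
    count (fun w => lexge ((i : nat) :: w) (k :: a)) (mons n (k + s - i)))).
    move/addIn => ->; apply: eq_count => w /=; by rewrite ltnn eqxx.
  move=> i; rewrite -val_eqE /= => ik; apply: eq_in_count => w /size_mem_mons sw /=.
  case: (ltngtP i k) ik => //= ik _; last by rewrite top //= sw.
  by apply/negP => /hd /=; rewrite sw leqNgt ik => /(_ erefl).
case: m sm => // x m [sm] /=; case: (ltngtP k x) => [kx|xk|<-] /=.
- by rewrite top //= sm.
- by apply/negP => /hd /=; rewrite sm leqNgt xk => /(_ erefl).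
- apply: (IH (fun w => A (k :: w))) => // u v su sv d; apply: bA; rewrite /= ?su ?sv //.
  exact: dominates_cons.
Qed.

(** * Uniqueness and non-uniqueness *)

(** A monomial of degree [s <= t] in the first [n] variables extends to degree [t] by exactly one
    power of the last variable. Hence a Hilbert polynomial fixes only partial sums of the counts in
    [n] variables. *)
Lemma count_last_free n A t : last_free n A ->
  count A (mons n.+1 t) = \sum_(s < t.+1) count (fun w => A (rcons w 0)) (mons n s).
Proof.
move=> fA; rewrite count_mons_rcons (reindex_inj rev_ord_inj) /=; apply: eq_bigr => s _.
rewrite subSS subKn; last by rewrite -ltnS.
by apply: eq_in_count => w /size_mem_mons sw; rewrite fA.
Qed.

Lemma lexge_last_free n a : size a <= n -> last_free n (lexge^~ a).
Proof. by move=> sa w x sw; rewrite !lexge_rconsl ?sw. Qed.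

Lemma borel_ideal0 n A : borel_ideal n.+1 A -> borel_ideal n (fun w => A (rcons w 0)).
Proof.
move=> bA u v su sv d; apply: bA; rewrite ?size_rcons ?su ?sv //.
by apply: dominates_rcons => //; rewrite ?su // !addn0; apply: dominates_sumn; rewrite ?su.
Qed.

Lemma sums_eq_leq (f g : nat -> nat) t0 : (forall t, t0 <= t -> \sum_(s < t.+1) f s = \sum_(s < t.+1) g s) ->
  (forall s, f s <= g s) -> forall s, f s = g s.
Proof.
move=> e le s; apply/eqP; rewrite eqn_leq le leqNgt /=; apply/negP => lt.
have st : s < (maxn s t0).+1 by rewrite ltnS leq_maxl.
have := @ltn_sum_ord (maxn s t0).+1 (fun i => f i) (fun i => g i) (Ordinal st) (fun j => le j) lt.
by rewrite e ?leq_maxr // ltnn.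
Qed.

Lemma sums_eq_tail (f g : nat -> nat) t0 : (forall t, t0 <= t -> \sum_(s < t.+1) f s = \sum_(s < t.+1) g s) ->
  forall s, t0 < s -> f s = g s.
Proof.
move=> e [|s] // st; have := e s.+1 (ltnW st).
by rewrite big_ord_recr /= e // [RHS]big_ord_recr /= => /addnI.
Qed.

Lemma lexge_dom1 u m : size u = size m -> sumn m <= 1 -> lexge u m -> dominates u m.
Proof.
elim: m u => [|x m IH] [|y u] //= [suv] sm /orP[xy|/andP[/eqP -> um]].
  by apply: (@dominates_big_head y u (x :: m)) => /=; lia.
by apply: dominates_cons => //; apply: IH => //; lia.
Qed.

(** If the heads tie, the tail of [m] has degree at most 1, where lexicographic comparison implies
    dominance; if not, the head of [u] alone reaches the degree of [m]. *)
Lemma lexge_dom_head u m : size u = size m -> sumn m <= (head 0 m).+1 -> lexge u m -> dominates u m.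
Proof.
case: m u => [|x m] [|y u] //= [suv] sm /orP[xy|/andP[/eqP -> um]].
  by apply: (@dominates_big_head y u (x :: m)) => /=; lia.
by apply: dominates_cons => //; apply: lexge_dom1 => //; lia.
Qed.

Theorem lex_unique_comb n A a t0 : borel_ideal n.+2 A -> last_free n.+1 A -> size a = n.+1 ->
  (forall t, t0 <= t -> count A (mons n.+2 t) = count (lexge^~ a) (mons n.+2 t)) ->
  last 0 a = 0 \/ sumn a <= (head 0 a).+2 ->
  forall m, size m = n.+2 -> A m = lexge m a.
Proof.
move=> bA fA sa ct cond.
pose A0 := fun w => A (rcons w 0); have bA0 : borel_ideal n.+1 A0 := borel_ideal0 bA.
pose cA s := count A0 (mons n.+1 s); pose cL s := count (lexge^~ a) (mons n.+1 s).
have sums t : t0 <= t -> \sum_(s < t.+1) cA s = \sum_(s < t.+1) cL s.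
  move=> tt; have := ct t tt; rewrite !count_last_free //; last by apply: lexge_last_free; rewrite sa.
  move=> ->; apply: eq_bigr => s _; apply: eq_in_count => w /size_mem_mons sw.
  by rewrite lexge_rconsl // sa sw.
have hd u : size u = n.+1 -> A0 u -> head 0 a <= head 0 u.
  case: u => // x u su Au; have sa2 : size a <= n.+2 by rewrite sa.
  by have := borel_head_bound bA sa2 ct _ Au; rewrite size_rcons su; apply.
(* A member [m] of [A0] outside the lexicographic ideal lies lexicographically below all of that
   ideal, hence is dominated by all of it. So [A0] contains the ideal in every degree, and the equal
   partial sums force equal counts. *)
have low s : s <= (head 0 a).+1 -> cA s <= cL s.
  move=> hs; rewrite leqNgt; apply/negP => lt.
  have : has (fun w => A0 w && ~~ lexge w a) (mons n.+1 s).
    apply: contraTT lt => /hasPn no; rewrite -leqNgt; apply: leq_count => u um Au.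
    by have := no u um; rewrite Au /= negbK.
  case/hasP=> m mm /andP[Am nm]; have sm := size_mem_mons mm.
  have LA i : cL i <= cA i.
    apply: leq_count => u /size_mem_mons su /= ua; apply: (bA0 u m) => //.
    apply: lexge_dom_head; rewrite ?su ?sm //.
      by rewrite (sumn_mem_mons mm) (leq_trans hs) // ltnS hd.
    by apply: (lexge_notl _ _ nm ua); rewrite sa ?sm ?su.
  have := sums_eq_leq (fun t tt => esym (sums t tt)) LA s.
  by rewrite /= => e; rewrite e ltnn in lt.
(* Dropping the last entry [z] gives an ideal whose membership ignores the last of the [n.+1]
   variables, so [lex_max_count] applies to it; [cL0] says where dropping [z] changes nothing. *)
have high s : last 0 a = 0 \/ sumn a <= s -> cA s <= cL s.
  case/lastP: a sa {cond low hd} @cL ct sums => // a z; rewrite size_rcons => -[sa] cL ct sums.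
  rewrite last_rcons sumn_rcons => hz.
  have cL0 i : z = 0 \/ sumn a + z <= i -> cL i = count (lexge^~ a) (mons n.+1 i).
    move=> hi; apply: eq_in_count => w wm /=; case/lastP: w wm => [|w y] wm; first by rewrite mem_mons in wm.
    have := size_mem_mons wm; rewrite size_rcons => -[sw].
    rewrite lexge_rcons ?sw ?sa // lexge_rconsl ?sw ?sa //.
    case: eqP => [wa|_]; rewrite /= ?andbT //; have := sumn_mem_mons wm; rewrite sumn_rcons wa => e.
    by rewrite (_ : z <= y) ?andbT //; case: hi => ?; lia.
  rewrite (cL0 s) //; apply: (@lex_max_count n A0 a (maxn t0 (sumn a + z)).+1) => // t tt.
  by rewrite -cL0; [apply: sums_eq_tail sums _ _; lia|right; lia].
have cAL s : cA s <= cL s.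
  case: cond => [a0|sa2]; first by apply: high; left.
  by have [le|lt] := leqP s (head 0 a).+1; [apply: low|apply: high; right; apply: leq_trans lt].
have U := lex_unique_hilbert bA0 sa (sums_eq_leq sums cAL).
move=> m; case/lastP: m => // w x; rewrite size_rcons => -[sw].
by rewrite fA // lexge_rconsl ?sw ?sa // -U.
Qed.

Lemma take_rcons_size (s : seq nat) x : take (size s) (rcons s x) = s.
Proof. by rewrite -cats1 take_size_cat. Qed.

Lemma count_lex_remove n a g t : size a <= n -> size g = n -> lexge g a -> sumn g <= t ->
  count (lexge^~ a) (mons n.+1 t) =
  (count (fun m => lexge m a && (take n m != g)) (mons n.+1 t)).+1.
Proof.
move=> sa sg ga gt; set J := fun m => _ && _.
have xm : rcons g (t - sumn g) \in mons n.+1 t by rewrite mem_mons size_rcons sg sumn_rcons eqxx; lia.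
rewrite -(@count_add1 _ J _ (rcons g (t - sumn g))) ?uniq_mons //; last first.
  by rewrite /J -sg take_rcons_size eqxx andbF.
apply: eq_in_count => m; case/lastP: m => [|w x] wm; first by rewrite mem_mons in wm.
have := size_mem_mons wm; rewrite size_rcons => -[sw].
rewrite /J lexge_rconsl ?sw // -sw take_rcons_size eqseq_rcons.
case: eqP => [wg|]; rewrite ?andbT ?andbF ?orbF //= wg ga.
by have := sumn_mem_mons wm; rewrite sumn_rcons wg => <-; rewrite addKn eqxx.
Qed.

Lemma lexge_sum0r w a : size a <= size w -> sumn w = 0 -> lexge w a -> sumn a = 0.
Proof.
elim: a w => [|y a IH] [|x w] //= sz h /orP[yx|/andP[/eqP e wa]]; first by lia.
by rewrite (IH w) //; lia.
Qed.

(* The competitor is obtained from the lexicographic ideal with one point less by removing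
   its lex-smallest element [g] of degree [head 0 a + 1], instead of [rcons a z]. *)
Theorem lex_not_unique_comb n a z : size a = n -> 0 < n -> (head 0 a).+2 <= sumn a + z ->
  exists J, [/\ borel_ideal n.+2 J, last_free n.+1 J,
    exists t0, forall t, t0 <= t -> count J (mons n.+2 t) = count (lexge^~ (rcons a z.+1)) (mons n.+2 t) &
    exists m, [/\ size m = n.+2, lexge m (rcons a z.+1) & ~~ J m]].
Proof.
move=> sa n0 hsum; set k := head 0 a in hsum *.
have hP : has (lexge^~ (rcons a z)) (mons n.+1 k.+1).
  apply/hasP; exists (k.+1 :: nseq n 0); first by rewrite mem_mons /= size_nseq sumn_nseq0 addn0 !eqxx.
  by rewrite /k; case: (a) sa n0 => [|y b] /= <- // _; rewrite ltnSn.
have [g [gm ga gmin]] := lexmin_exists (@size_mem_mons n.+1 k.+1) hP.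
have sg := size_mem_mons gm; have tg := sumn_mem_mons gm.
have sz : size (rcons a z) = n.+1 by rewrite size_rcons sa.
exists (fun m => lexge m (rcons a z) && (take n.+1 m != g)); split.
- move=> u v su sv d /andP[va vg]; have szv : size (rcons a z) <= n.+2 by rewrite sz.
  rewrite (lexge_borel szv su sv d va) /=; apply: contraNN vg => /eqP ug; apply/eqP.
  have tv : size (take n.+1 v) = n.+1 by rewrite size_takel ?sv.
  have dg : dominates g (take n.+1 v).
    move=> i; by rewrite -ug -!take_min; apply: d.
  have va' : lexge (take n.+1 v) (rcons a z).
    case/lastP: v sv va {d tv dg} => // w x; rewrite size_rcons => -[sw].
    by rewrite -sw take_rcons_size lexge_rconsl ?sw ?sz.
  have := dominates_sumn (etrans sg (esym tv)) dg; rewrite tg leq_eqVlt => /predU1P[e|lt].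
    apply: lexge_anti; rewrite ?sg ?tv //; last exact: dominates_lexge.
    by apply: gmin => //; rewrite mem_mons tv e !eqxx.
  (* A member of degree at most [k] can only be the power [k] of the first variable. This forces all
     entries of [rcons a z] after the first to vanish, against [hsum]. *)
  exfalso; move: va' lt hsum; rewrite /k.
  case: (take n.+1 v) tv => // x w [sw]; case: (a) sa n0 => [|y b] /= sb; first by rewrite -sb.
  move=> _.
  case/orP=> [yx|/andP[/eqP -> wb]] lt; first by lia.
  have /(_ _ _ wb) := @lexge_sum0r w (rcons b z); rewrite size_rcons sw sumn_rcons -sb; lia.
- move=> w x sw; rewrite !lexge_rconsl ?sw ?sz //.
  by rewrite -sw !take_rcons_size.
(* Both sets arise from the ideal of [rcons a z] by removing the multiples of one element by powers
   of the last variable: [g] for one, [rcons a z] for the other. *)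
- exists (sumn (rcons a z.+1) + k.+1) => t tt.
  apply/eqP; rewrite -eqSS -count_lex_remove ?sz ?tg //; last by lia.
  rewrite (@count_lex_remove n.+1 (rcons a z) (rcons a z)) ?sz ?lexge_refl //; last first.
    by move: tt; rewrite !sumn_rcons; lia.
  rewrite eqSS; apply/eqP/eq_in_count => m; case/lastP: m => [|w x] wm; first by rewrite mem_mons in wm.
  have := size_mem_mons wm; rewrite size_rcons => -[sw].
  rewrite !lexge_rconsl ?size_rcons ?sw ?sa // -sw take_rcons_size.
  case/lastP: w sw {wm} => // w y; rewrite size_rcons => -[sw].
  rewrite !lexge_rcons ?sw ?sa // eqseq_rcons; case: eqP => //= _; last by rewrite !andbT.
  by rewrite -andbA ltn_neqAle eq_sym [(z <= y) && _]andbC.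
(* The degree [k.+1] of [g] is less than [sumn a + z], so [g] differs from [rcons a z] and stays in
   the original ideal. *)
- exists (rcons g 0); rewrite size_rcons sg -sg take_rcons_size eqxx andbF; split=> //.
  rewrite lexge_rconsl ?size_rcons ?sg ?sa //.
  case/lastP: g {gmin} gm ga sg tg => // g y _; rewrite size_rcons sumn_rcons => + [sg] e.
  rewrite !lexge_rcons ?sg ?sa //; case: eqP => //= ga /andP[-> zy]; rewrite ltn_neqAle zy andbT /=.
  by apply/eqP => zy'; move: e hsum; rewrite ga zy'; lia.
Qed.

(** * Hilbert functions of ideals *)

Local Open Scope ring_scope.

(** Classical truth values, so that monomials selected by an ideal can be counted. *)
Definition pbool (P : Prop) : bool := if excluded_middle_informative P then true else false.

Lemma pboolP P : reflect P (pbool P).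
Proof. by rewrite /pbool; case: excluded_middle_informative => h; constructor. Qed.

Section Exponents.
Variable N : nat.

Definition expts (m : 'X_{1..N}) : seq nat := tval (multinom_val m).
Definition mnm_of (s : seq nat) : 'X_{1..N} := [multinom nth 0%N s i | i < N].

Lemma size_expts m : size (expts m) = N.
Proof. exact: size_tuple. Qed.

Lemma nth_expts m (i : 'I_N) : nth 0%N (expts m) i = m i.
Proof. by rewrite mnm_tnth (tnth_nth 0%N). Qed.

Lemma exptsK m : mnm_of (expts m) = m.
Proof. by apply/mnmP => i; rewrite mnmE nth_expts. Qed.

Lemma mnm_ofK s : size s = N -> expts (mnm_of s) = s.
Proof.
move=> sN; apply: (@eq_from_nth _ 0%N); first by rewrite size_expts.
by move=> i; rewrite size_expts => iN; rewrite (nth_expts _ (Ordinal iN)) mnmE.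
Qed.

Lemma sumn_expts m : sumn (expts m) = mdeg m.
Proof. by rewrite sumnE. Qed.

Lemma mem_expts m : expts m \in mons N (mdeg m).
Proof. by rewrite mem_mons size_expts sumn_expts !eqxx. Qed.

Lemma mdeg_mnm_of s : size s = N -> mdeg (mnm_of s) = sumn s.
Proof. by move=> sN; rewrite -sumn_expts mnm_ofK. Qed.

Lemma card_monos (P : pred (seq nat)) t :
  #|[set m in monos N t | P (expts (bmnm m))]| = count P (mons N t).
Proof.
rewrite cardE -size_filter -(size_map (fun m : 'X_{1..N < t.+1} => expts m)).
apply: perm_size; apply: uniq_perm.
- rewrite map_inj_uniq ?enum_uniq // => m m' e; apply: val_inj.
  by rewrite -[val m]exptsK -[val m']exptsK e.
- by rewrite filter_uniq // uniq_mons.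
move=> s; rewrite mem_filter; apply/mapP/andP.
  case=> m; rewrite mem_enum !inE => /andP[/eqP dm Pm] ->; split=> //.
  by have := mem_expts (bmnm m); rewrite dm.
case=> Ps ms; have sN := size_mem_mons ms.
have dm : mdeg (mnm_of s) = t by rewrite mdeg_mnm_of // (sumn_mem_mons ms).
have lt : (mdeg (mnm_of s) < t.+1)%N by rewrite dm.
exists (BMultinom lt); last by rewrite mnm_ofK.
by rewrite mem_enum !inE /= dm eqxx mnm_ofK.
Qed.

Lemma card_monosT t : #|monos N t| = size (mons N t).
Proof.
rewrite -count_predT -card_monos; apply: eq_card => m.
by rewrite inE andbT.
Qed.

End Exponents.

Section HilbertFunction.
Variables (k : fieldType) (N : nat).
Notation poly := {mpoly k[N]}.
Variable I : poly -> Prop.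
Hypothesis idI : is_ideal I.

Lemma idealZ c f : I f -> I (c *: f).
Proof. by case: idI => _ [_ h] If; rewrite -mul_mpolyC; apply: h. Qed.

Lemma ideal_sum (T : Type) (r : seq T) (P : pred T) (F : T -> poly) :
  (forall i, P i -> I (F i)) -> I (\sum_(i <- r | P i) F i).
Proof. by case: idI => I0 [ID _] h; apply: (big_ind I). Qed.

(** The monomials of the initial ideal of [I], which has the same Hilbert function. *)
Definition lead_of (m : 'X_{1..N}) : Prop :=
  exists f, [/\ I f, is_homog_of (mdeg m) f, f != 0 & mlead f = m].

Definition leads : pred (seq nat) := fun s => pbool (lead_of (mnm_of N s)).

Definition std_mons t := [seq mnm_of N s | s <- mons N t & ~~ leads s].

Lemma size_std_mons t : size (std_mons t) = count (predC leads) (mons N t).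
Proof. by rewrite size_map size_filter. Qed.

Lemma std_monsP t m : reflect (mdeg m = t /\ ~ lead_of m) (m \in std_mons t).
Proof.
apply: (iffP mapP) => [[s]|[<- nl]].
  rewrite mem_filter => /andP[ns ms] ->; rewrite mdeg_mnm_of ?(size_mem_mons ms) //.
  by rewrite (sumn_mem_mons ms); split=> // l; case/negP: ns; apply/pboolP.
exists (expts m); last by rewrite exptsK.
by rewrite mem_filter mem_expts andbT /leads exptsK; apply/negP => /pboolP.
Qed.

Lemma uniq_std_mons t : uniq (std_mons t).
Proof.
rewrite map_inj_in_uniq ?filter_uniq ?uniq_mons // => s s'.
rewrite !mem_filter => /andP[_ ms] /andP[_ ms'] e.
by rewrite -(mnm_ofK (size_mem_mons ms)) e mnm_ofK // (size_mem_mons ms').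
Qed.

Lemma mcoeff_lin (V : seq 'X_{1..N}) (c : nat -> k) m :
  (\sum_(i < size V) c i *: 'X_[nth 0%MM V i])@_m = \sum_(i < size V) c i * (nth 0%MM V i == m)%:R.
Proof. by rewrite raddf_sum; apply: eq_bigr => i _; rewrite /= mcoeffZ mcoeffX. Qed.

Lemma msupp_lin (V : seq 'X_{1..N}) (c : nat -> k) m :
  m \in msupp (\sum_(i < size V) c i *: 'X_[nth 0%MM V i]) -> m \in V.
Proof.
rewrite mcoeff_msupp mcoeff_lin; apply: contraR => nm; apply/eqP/big1 => i _.
by case: eqP => [e|]; rewrite ?mulr0 //; move: nm; rewrite -e mem_nth.
Qed.

(** A nonzero combination lying in [I] would have a standard monomial as its leading monomial. *)
Lemma std_indep t : indep_mod I [seq ('X_[m] : poly) | m <- std_mons t].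
Proof.
set V := std_mons t => c sc; rewrite size_map in sc *.
rewrite (eq_bigr (fun i : 'I_(size V) => c`_i *: 'X_[nth 0%MM V i])); last first.
  by move=> i _; rewrite (nth_map 0%MM).
move=> If i; have [iV|] := ltnP i (size V); last by move=> h; rewrite nth_default // sc.
set f := \sum_(i < size V) _ in If.
have -> : c`_i = f@_(nth 0%MM V i).
  rewrite /f (mcoeff_lin V (fun i => c`_i)) (bigD1 (Ordinal iV)) //= eqxx mulr1 big1 ?addr0 // => j ji.
  rewrite nth_uniq ?uniq_std_mons // (_ : (j == i :> nat) = false) ?mulr0 //.
  by apply/negbTE; apply: contraNneq ji => e; apply/eqP/val_inj.
have [->|f0] := eqVneq f 0; first by rewrite mcoeff0.
have mV := msupp_lin (mlead_supp f0); have [dm []] := std_monsP _ _ mV.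
exists f; split=> //; apply/allP => m /msupp_lin /std_monsP[-> _]; exact/eqP.
Qed.

(** Division with remainder, by well-founded induction on the monomial order: a form of [I] with
    leading monomial [m] rewrites [m] through smaller monomials of the same degree. *)
Lemma reduce_mon m : exists g : poly, {subset msupp g <= std_mons (mdeg m)} /\ I ('X_[m] - g).
Proof.
elim/(@ltmwf N): m => m IH.
case: (excluded_middle_informative (lead_of m)) => [|nl]; last first.
  exists 'X_[m]; split; last by rewrite subrr; case: idI.
  by move=> u; rewrite msuppX inE => /eqP->; apply/std_monsP.
case=> f [If hf f0 lm].
have redsum (r : seq 'X_{1..N}) : {in r, forall u, (u < m)%O && (mdeg u == mdeg m)} ->
    exists g, {subset msupp g <= std_mons (mdeg m)} /\ I (\sum_(u <- r) f@_u *: 'X_[u] - g).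
  elim: r => [|u r IHr] h; first by exists 0; rewrite big_nil subr0 msupp0; split=> //; case: idI.
  have [|g [sg Ig]] := IHr; first by move=> v vr; apply: h; rewrite inE vr orbT.
  have /andP[um /eqP du] := h u (mem_head _ _).
  have [g' [sg' Ig']] := IH u um.
  exists (f@_u *: g' + g); split.
    move=> v /msuppD_le; rewrite mem_cat => /orP[/msuppZ_le|]; last exact: sg.
    by rewrite -du; apply: sg'.
  rewrite big_cons opprD addrACA -scalerBr; case: idI => _ [ID _].
  by apply: ID => //; apply: idealZ.
have supp_m : m \in msupp f by rewrite -lm mlead_supp.
have [|g [sg Ig]] := redsum [seq u <- msupp f | u != m].
  move=> u; rewrite mem_filter => /andP[um uf]; have := msupp_le_mlead uf.
  by rewrite lm lt_neqAle um => -> /=; apply: (allP hf).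
exists (- (f@_m)^-1 *: g); split; first by move=> u /msuppZ_le; apply: sg.
have fm0 : f@_m != 0 by rewrite -mcoeff_msupp.
set S := \sum_(u <- _) _ in Ig.
have -> : 'X_[m] - (- (f@_m)^-1 *: g) = (f@_m)^-1 *: (f - (S - g)).
  have ef : f = f@_m *: 'X_[m] + S.
    by rewrite {1}(mpolyE f) (bigD1_seq m) ?msupp_uniq //= /S big_filter.
  by rewrite [X in _ *: (X - _)]ef opprB addrACA subrr addr0 scalerDr scalerA mulVf // scale1r scaleNr opprK.
apply: idealZ; case: idI => _ [ID _]; apply: ID => //.
by rewrite -scaleN1r; apply: idealZ.
Qed.

Lemma lin_dep (V : seq 'X_{1..N}) (gs : seq poly) :
  {in gs, forall g : poly, {subset msupp g <= V}} -> (size V < size gs)%N ->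
  exists c : seq k, [/\ size c = size gs, \sum_(i < size gs) c`_i *: gs`_i = 0 & exists i, c`_i != 0].
Proof.
move=> sV lt; pose M := \matrix_(i < size gs, j < size V) (gs`_i)@_(nth 0%MM V j).
have : kermx M != 0.
  rewrite kermx_eq0; apply: contraL lt; rewrite /row_free -leqNgt => /eqP <-.
  exact: rank_leq_col.
case/rowV0Pn=> v /sub_kermxP vM v0.
have cE (i : 'I_(size gs)) : [tuple v 0 i | i < size gs]`_i = v 0 i by rewrite nth_mktuple.
exists [tuple v 0 i | i < size gs]; rewrite size_tuple; split=> //; last first.
  by case/rV0Pn: v0 => i vi; exists i; rewrite cE.
apply/mpolyP => m; rewrite mcoeff0 raddf_sum /=.
have [mV|nm] := boolP (m \in V); last first.
  apply: big1 => i _; rewrite mcoeffZ memN_msupp_eq0 ?mulr0 //.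
  by apply: contra nm; apply: sV; apply: mem_nth.
have jV : (index m V < size V)%N by rewrite index_mem.
move/rowP/(_ (Ordinal jV)): vM; rewrite !mxE => vM; rewrite -[RHS]vM; apply: eq_bigr => i _.
by rewrite mcoeffZ cE mxE nth_index.
Qed.

Lemma reduce_form t f : is_homog_of t f -> exists g : poly, {subset msupp g <= std_mons t} /\ I (f - g).
Proof.
move=> hf; rewrite {1}(mpolyE f); move/allP: hf.
elim: (msupp f) => [|u r IHr] h; first by exists 0; rewrite big_nil subr0 msupp0; split=> //; case: idI.
have [|g [sg Ig]] := IHr; first by move=> v vr; apply: h; rewrite inE vr orbT.
have /eqP du := h u (mem_head _ _).
have [g' [sg' Ig']] := reduce_mon u.
exists (f@_u *: g' + g); split.
  move=> v /msuppD_le; rewrite mem_cat => /orP[/msuppZ_le|]; last exact: sg.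
  by rewrite -du; apply: sg'.
rewrite big_cons opprD addrACA -scalerBr; case: idI => _ [ID _].
by apply: ID => //; apply: idealZ.
Qed.

(** The remainders of too many forms are linearly dependent in the span of the standard monomials,
    and the dependency lifts to one modulo [I]. *)
Lemma indep_size t (s : seq poly) : all (is_homog_of t) s -> indep_mod I s ->
  (size s <= size (std_mons t))%N.
Proof.
move=> hs ind; rewrite leqNgt; apply/negP => lt.
have [gs [sgs Vgs Igs]] : exists gs : seq poly, [/\ size gs = size s,
    {in gs, forall g : poly, {subset msupp g <= std_mons t}} &
    forall i, I (s`_i - gs`_i)].
  elim: s hs {ind lt} => [_|f s IH /= /andP[hf hs]].
    by exists [::]; split=> // i; rewrite !nth_nil subrr; case: idI.
  have [gs [sgs Vgs Igs]] := IH hs; have [g [sg Ig]] := reduce_form hf.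
  exists (g :: gs); rewrite /= sgs; split=> //; last by case.
  by move=> g'; rewrite inE => /predU1P[->|]; [|apply: Vgs].
have [|c [sc c0 [i ci]]] := @lin_dep (std_mons t) gs Vgs; first by rewrite sgs.
case/negP: ci; apply/eqP; apply: ind; first by rewrite sc sgs.
have -> : \sum_(j < size s) c`_j *: s`_j = \sum_(j < size s) c`_j *: (s`_j - gs`_j).
  under [RHS]eq_bigr => j _ do rewrite scalerBr.
  by move: c0; rewrite sumrB sgs => ->; rewrite subr0.
by apply: ideal_sum => j _; apply: idealZ.
Qed.

Lemma hilb_funP t h : hilb_fun I t h <-> h = count (predC leads) (mons N t).
Proof.
have st : all (is_homog_of t) [seq ('X_[m] : poly) | m <- std_mons t].
  apply/allP => f /mapP[m /std_monsP[dm _] ->]; apply/allP => u.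
  by rewrite msuppX inE => /eqP->; apply/eqP.
rewrite -size_std_mons; split=> [[[s [<- [hs ind]]] mx]|->].
  apply/eqP; rewrite eqn_leq indep_size //=.
  by have := mx _ st (@std_indep t); rewrite size_map.
split; last by move=> s; apply: indep_size.
by exists [seq ('X_[m] : poly) | m <- std_mons t]; rewrite size_map; split=> //; split=> //; apply: std_indep.
Qed.

Lemma mnm_of_dec p x q : size (p ++ x.+1 :: q) = N ->
  exists i, mnm_of N (p ++ x.+1 :: q) = (mnm_of N (p ++ x :: q) + U_(i))%MM.
Proof.
move=> sN; have pN : (size p < N)%N by rewrite -sN size_cat /=; lia.
exists (Ordinal pN); apply/mnmP => j; rewrite mnmDE mnm1E -val_eqE /= !mnmE.
rewrite !nth_cat; case: (ltngtP j (size p)) => [h|h|->]; rewrite ?addn0 ?subnn ?addn1 //.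
by rewrite -(subnSK h) /= ?addn0.
Qed.

Lemma leads_shadow m : size m = N -> shadow leads m -> leads m.
Proof.
move=> sm /shadowP[p [x [q [em /pboolP[f [If hf f0 lf]]]]]]; apply/pboolP; rewrite em.
have [|i ei] := @mnm_of_dec p x q; first by rewrite -em.
have X0 : 'X_[U_(i)] != 0 :> poly by rewrite -msupp_eq0 msuppX.
exists ('X_[U_(i)] * f); split.
- by case: idI => _ [_ h]; apply: h.
- apply/allP => u /msuppM_le /allpairsP[[u1 u2] [/=]]; rewrite msuppX inE => /eqP-> h2 ->.
  by rewrite ei !mdegD mdeg1 addnC (eqP (allP hf _ h2)).
- exact: mulf_neq0.
- by rewrite mleadM // mleadXm lf ei addmC.
Qed.
End HilbertFunction.

(** * Borel ideals of polynomials *)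

Lemma sumn_take_nth (s : seq nat) l :
  sumn (take l s) = (\sum_(j < size s | (j < l)%N) nth 0%N s j)%N.
Proof.
elim: s l => [|x s IH] [|l]; rewrite ?big_ord0 //=; first by rewrite big_pred0.
by rewrite big_mkcond big_ord_recl /= IH [in LHS]big_mkcond.
Qed.

Lemma sumn_take_expts N (m : 'X_{1..N}) l : sumn (take l (expts m)) = (\sum_(j < N | (j < l)%N) m j)%N.
Proof.
rewrite sumn_take_nth; have : size (expts m) = N := size_expts m.
move=> e; rewrite (big_ord_widen_cond N (fun j => (j < l)%N) (fun j => nth 0%N (expts m) j)) ?e //.
by apply: eq_big => [j|j _]; rewrite ?ltn_ord ?andbT // nth_expts.
Qed.

Lemma dominates_expts_add N (m m' : 'X_{1..N}) : dominates (expts (m + m')%MM) (expts m).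
Proof. by move=> l; rewrite !sumn_take_expts; apply: leq_sum => j _; rewrite mnmDE leq_addr. Qed.

Lemma dominates_expts_move N (m : 'X_{1..N}) (i j : 'I_N) : (i < j)%N -> (0 < m j)%N ->
  dominates (expts (m - U_(j) + U_(i))%MM) (expts m).
Proof.
move=> ij mj l; rewrite !sumn_take_expts.
(* The subtraction is moved across, so that the sums split over the natural numbers. *)
have e (q : 'I_N) : (m q + (i == q) = (m - U_(j) + U_(i))%MM q + (j == q))%N.
  by rewrite mnmDE mnmBE !mnm1E; case: (eqVneq j q) => [<-|]; lia.
have s1 (z : 'I_N) : (\sum_(q < N | (q < l)%N) (z == q) = (z < l))%N.
  case zl: (z < l)%N; first by rewrite (bigD1 z) //= eqxx big1 // => q /andP[_]; rewrite eq_sym => /negbTE->.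
  by rewrite big1 // => q ql; case: eqP => // zq; rewrite zq ql in zl.
have : (\sum_(q < N | (q < l)%N) (m q + (i == q)) =
        \sum_(q < N | (q < l)%N) ((m - U_(j) + U_(i))%MM q + (j == q)))%N.
  by apply: eq_bigr => q _; apply: e.
by rewrite !big_split /= !s1; lia.
Qed.

Section MonomialIdeals.
Variables (k : fieldType) (N : nat).
Notation poly := {mpoly k[N]}.

Definition monomial_span (A : pred (seq nat)) : poly -> Prop :=
  fun f => forall m, m \in msupp f -> A (expts m).

Definition monos_of (J : poly -> Prop) : pred (seq nat) := fun s => pbool (J 'X_[mnm_of N s]).

Lemma monomial_spanX A m : monomial_span A 'X_[m] <-> A (expts m).
Proof. by split=> [|Am u]; [apply; rewrite msuppX mem_head|rewrite msuppX inE => /eqP->]. Qed.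

Lemma monomial_span_borel A : borel_ideal N A -> borel (monomial_span A).
Proof.
move=> bA; have up (m u : 'X_{1..N}) : dominates (expts u) (expts m) -> A (expts m) -> A (expts u).
  by apply: bA; rewrite size_expts.
split=> [|m i j /monomial_spanX Am ij mj]; last exact/monomial_spanX/(up m)/Am/dominates_expts_move.
split; last by move=> f; split=> h m /h; [move/monomial_spanX|move/monomial_spanX].
split; first by move=> m; rewrite msupp0.
split=> [f g hf hg m /msuppD_le|f g hf m /msuppM_le /allpairsP[[u v] [/= _ vf ->]]].
  by rewrite mem_cat => /orP[/hf|/hg].
by apply: (up v) (hf v vf); rewrite addmC; apply: dominates_expts_add.
Qed.

Lemma monos_of_monid A s : size s = N -> monos_of (monomial_span A) s = A s.
Proof. by move=> sN; apply/pboolP/idP => [/monomial_spanX|As]; [|apply/monomial_spanX]; rewrite mnm_ofK. Qed.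

Lemma leads_monomial J t : monomial_ideal J -> {in mons N t, leads J =1 monos_of J}.
Proof.
case=> _ mJ s ms; apply/pboolP/pboolP => [[f [Jf _ f0 <-]]|Js].
  exact: (proj1 (mJ f) Jf _ (mlead_supp f0)).
exists 'X_[mnm_of N s]; split; rewrite ?mleadXm //.
  by apply/allP => u; rewrite msuppX inE => /eqP->.
by rewrite -msupp_eq0 msuppX.
Qed.

Lemma monomial_hilb J b : monomial_ideal J ->
  has_hilb_poly J b <-> exists t0, forall t, (t0 <= t)%N -> gotz b t = count (predC (monos_of J)) (mons N t).
Proof.
move=> mJ; split=> -[t0 h]; exists t0 => t /h; rewrite hilb_funP; try exact: (proj1 mJ);
  by move=> ->; apply: eq_in_count => s /(leads_monomial mJ) /= ->.
Qed.

Lemma monomial_monid J f : monomial_ideal J -> J f <-> monomial_span (monos_of J) f.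
Proof.
case=> _ mJ; rewrite mJ; split=> h m /h; first by move=> Jm; apply/pboolP; rewrite exptsK.
by move/pboolP; rewrite exptsK.
Qed.

End MonomialIdeals.

Section Saturation.
Variables (k : fieldType) (n : nat).
Notation poly := {mpoly k[n.+1]}.

(** Multiplication by the last variable first raises [v] to the degree of [u] and keeps it
    dominated; adjacent Borel moves then lead to [u]. *)
Lemma monos_of_borel (J : poly -> Prop) : borel J -> borel_ideal n.+1 (monos_of J).
Proof.
move=> [[idJ mJ] mvJ].
have up m u : J 'X_[m] -> J 'X_[(m + u)%MM].
  by case: idJ => _ [_ h]; rewrite addmC mpolyXD; apply: h.
have adj t p x y q : p ++ x :: y.+1 :: q \in mons n.+1 t ->
    monos_of J (p ++ x :: y.+1 :: q) -> monos_of J (p ++ x.+1 :: y :: q).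
  move=> /size_mem_mons sN /pboolP Jm; apply/pboolP.
  have i1 : ((size p).+1 < n.+1)%N by rewrite -sN size_cat /=; lia.
  pose j := Ordinal i1; pose i := Ordinal (ltnW i1).
  have nj : mnm_of n.+1 (p ++ x :: y.+1 :: q) j = y.+1.
    by rewrite mnmE nth_cat /= ltnNge leqnSn /= subSnn.
  have := mvJ _ i j Jm (ltnSn _); rewrite nj => /(_ isT).
  rewrite (_ : (_ - _ + _)%MM = mnm_of n.+1 (p ++ x.+1 :: y :: q)) //.
  apply/mnmP => l; rewrite mnmDE mnmBE !mnm1E -!val_eqE /= !mnmE !nth_cat /=.
  case: (ltngtP l (size p)) => [h|h|->]; first by rewrite (gtn_eqF (leqW h)) subn0 addn0.
    rewrite addn0; case: (ltngtP (size p).+1 l) => [h'|h'|<-]; last by rewrite subSnn /= subn1.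
      by rewrite subn0 -(subnSK h) -(subnSK h').
    by rewrite ltnS leqNgt h in h'.
  by rewrite subnn /= addn1 (_ : (_ == _) = false) ?subn0 // gtn_eqF.
move=> u v su sv d Av.
case/lastP: v sv d Av => // w x sw d Av.
have le := dominates_sumn (etrans su (esym sw)) d; rewrite sumn_rcons in le.
pose z := (x + (sumn u - (sumn w + x)))%N.
have Az : monos_of J (rcons w z).
  have -> : monos_of J (rcons w z) =
      pbool (J 'X_[mnm_of n.+1 (rcons w x) + mnm_of n.+1 (rcons (nseq n 0%N) (z - x)%N)]).
    congr (pbool (J 'X_[_])); apply/mnmP => l; rewrite mnmDE !mnmE !nth_rcons size_nseq.
    move: sw; rewrite size_rcons => -[->]; case: ltngtP => // [h|_]; last by rewrite /z addKn.
    by rewrite nth_nseq h addn0.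
  by apply/pboolP/up/pboolP.
have mz : rcons w z \in mons n.+1 (sumn u).
  by rewrite mem_mons size_rcons -sw size_rcons eqxx sumn_rcons /z; apply/eqP; lia.
apply: (adjacent_borel (adj (sumn u)) _ mz _ Az); first by rewrite mem_mons su !eqxx.
move=> i; have [iw|wi] := leqP i (size w).
  have := d i; rewrite -!cats1 !take_cat; case: ltnP => // h.
  by rewrite (eqP (_ : i == size w)) ?subnn ?take0 // eqn_leq iw.
have -> : take i u = u by rewrite take_oversize // su -sw size_rcons.
by rewrite take_oversize ?size_rcons // (sumn_mem_mons mz).
Qed.

(** Replacing the power [x] of the last variable by any monomial of degree [x] gives a dominating
    monomial, so [w] multiplied by all of degree [x] lies in [J], and saturation yields [w]
    itself. *)
Lemma monos_of_last_free (J : poly -> Prop) : borel J -> saturated J -> last_free n (monos_of J).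
Proof.
move=> bJ satJ w x sw; have bA := monos_of_borel bJ.
have up (m u : 'X_{1..n.+1}) : dominates (expts u) (expts m) -> monos_of J (expts m) -> monos_of J (expts u).
  by apply: bA; rewrite size_expts.
apply/idP/idP => h; last by apply: bA h; rewrite ?size_rcons ?sw //; apply: dominates_last.
apply/pboolP/satJ; exists x => m dm; rewrite -mpolyXD.
have : monos_of J (expts (mnm_of n.+1 (rcons w 0%N) + m)%MM); last by move/pboolP; rewrite exptsK.
apply: bA h; rewrite ?size_expts ?size_rcons ?sw // => i.
have [iw|wi] := leqP i (size w).
  apply: (@leq_trans (sumn (take i (rcons w 0%N)))).
    rewrite -!cats1 !take_cat; case: ltnP => // h.
    by rewrite (eqP (_ : i == size w)) ?subnn ?take0 // eqn_leq iw.
  have := @dominates_expts_add _ (mnm_of n.+1 (rcons w 0%N)) m i.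
  by rewrite mnm_ofK // size_rcons sw.
rewrite !take_oversize ?size_expts ?size_rcons -?sw //.
by rewrite sumn_expts mdegD dm mdeg_mnm_of ?size_rcons ?sw // !sumn_rcons addn0.
Qed.

Lemma monomial_span_saturated A : borel_ideal n.+1 A -> last_free n A -> saturated (@monomial_span k n.+1 A).
Proof.
move=> bA fA f; split; last first.
  move=> hf; exists 0%N => m dm u.
  by move/eqP: dm; rewrite mdeg_eq0 => /eqP->; rewrite mpolyX0 mulr1; apply: hf.
case=> K hK m mf.
have sK : size (rcons (nseq n 0%N) K) = n.+1 by rewrite size_rcons size_nseq.
have := hK (mnm_of n.+1 (rcons (nseq n 0%N) K)); rewrite mdeg_mnm_of // sumn_rcons sumn_nseq0.
move=> /(_ erefl (m + mnm_of n.+1 (rcons (nseq n 0%N) K))%MM).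
rewrite (perm_mem (msuppMX _ _)) addmC map_f // => /(_ isT).
have e1 := size_expts m; case/lastP: (expts m) e1 (exptsK m) => // w x; rewrite size_rcons => -[sw] em.
rewrite fA // (_ : expts _ = rcons w (x + K)%N) ?fA //.
rewrite -em -[RHS](@mnm_ofK n.+1) ?size_rcons ?sw //; congr expts; apply/mnmP => l.
rewrite mnmDE !mnmE !nth_rcons size_nseq sw; case: ltngtP => // [h|_]; last by rewrite addnC.
by rewrite nth_nseq h.
Qed.

End Saturation.

(** * The lexicographic ideal *)

Lemma lexge_notP (u v : seq nat) : size u = size v ->
  reflect (exists i, [/\ (i < size u)%N, (nth 0 v i < nth 0 u i)%N &
    forall j, (j < i)%N -> nth 0%N u j = nth 0%N v j])
          (~~ lexge v u).
Proof.
move=> s; apply: (iffP idP); elim: u v s => [|x u IH] [|y v] //= s; try by case: s.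
- case: s => s; rewrite negb_or negb_and -leqNgt => /andP[yx]; case: eqP => [<- /= h|yx' _].
    have [i [iu lt e]] := IH v s h; exists i.+1; split=> // -[|j] //; exact: e.
  by exists 0%N; split=> //=; lia.
- by case=> -[|i] [].
case: s => s; case=> -[|i] [iu /= lt e]; first by case: (ltngtP x y) lt.
have /= <- := e 0%N isT; rewrite ltnn eqxx /=; apply: IH => //.
by exists i; split=> // j ji; apply: (e j.+1).
Qed.

Lemma lexgtE N (u v : 'X_{1..N}) : lexgt u v = ~~ lexge (expts v) (expts u).
Proof.
apply/existsP/lexge_notP; first by rewrite !size_expts.
  case=> i /andP[/forallP h lt]; exists i; rewrite size_expts ltn_ord !nth_expts; split=> // j ji.
  have jN := ltn_trans ji (ltn_ord i); have := h (Ordinal jN); rewrite /= ji /= => /eqP.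
  by rewrite -!nth_expts.
case=> i; rewrite size_expts => -[iN lt e]; exists (Ordinal iN).
rewrite -!nth_expts /= lt andbT; apply/forallP => j; apply/implyP => ji.
by rewrite -!nth_expts; apply/eqP/e.
Qed.

(** The lex segment of size [d], in the form in which [lex_ideal] describes it. *)
Definition lexrank_lt N t d : pred (seq nat) :=
  fun s => (count (fun s' => ~~ lexge s s') (mons N t) < d)%N.

Lemma lexrank_seg N t d : lexseg_at N t (lexrank_lt N t d).
Proof.
move=> u v um vm uv; apply: leq_ltn_trans; apply: leq_count => w wm; apply: contraNN => vw.
by apply: lexge_trans vw; rewrite ?(size_mem_mons wm) ?(size_mem_mons vm).
Qed.

Lemma lexrank_count N t d : (d <= size (mons N t))%N -> count (lexrank_lt N t d) (mons N t) = d.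
Proof.
move=> dN; have [S sS cS] := lexseg_exists dN; rewrite -[RHS]cS; apply: eq_in_count => m mm.
rewrite /lexrank_lt -cS; apply/idP/idP.
  apply: contraLR => nS; rewrite -leqNgt; apply: leq_count => u um Su.
  by apply: contraNN nS => mu; apply: (sS m u).
move=> Sm; rewrite -(@count_add1 _ _ _ m) ?uniq_mons ?lexge_refl //.
apply: leq_count => u um /orP[nmu|/eqP->] //; apply: (sS u m) => //.
by have := lexge_total u m; rewrite (negbTE nmu) orbF.
Qed.

Section LexIdeal.
Variables (k : fieldType) (n : nat) (I : {mpoly k[n.+1]} -> Prop) (b : seq nat).
Hypotheses (idI : is_ideal I) (hI : has_hilb_poly I b).
Hypotheses (sb : sorted geq b) (bn : all (fun x => (x < n)%N) b).
Notation N := n.+1.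
Notation a := (mult_vec n b).

Let d t := count (leads I) (mons N t).
Let Lx t := lexrank_lt N t (d t).

Lemma lex_idealP f : lex_ideal I f <-> forall m, m \in msupp f -> Lx (mdeg m) (expts m).
Proof.
have e m : #|[set m' in monos N (mdeg m) | lexgt m' m]| =
    count (fun s' => ~~ lexge (expts m) s') (mons N (mdeg m)).
  by rewrite -card_monos; apply: eq_card => m'; rewrite !inE lexgtE.
have dE t : (#|monos N t| - count (predC (leads I)) (mons N t))%N = d t.
  by rewrite card_monosT -(count_predC (leads I)) addnK.
split=> h m /h; first by case=> x [/(hilb_funP idI) ->]; rewrite e dE.
move=> lx; exists (count (predC (leads I)) (mons N (mdeg m))); split; first exact/hilb_funP.
by rewrite e dE.
Qed.

(** Macaulay's theorem bounds the shadow of [Lx t] by that of the leading monomials, which stays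
    among the leading monomials of degree [t.+1]; lex segments are nested by size. *)
Lemma Lx_shadow t : {in mons N t.+1, forall m, shadow (Lx t) m -> Lx t.+1 m}.
Proof.
have c t' : count (Lx t') (mons N t') = d t' by apply: lexrank_count; apply: count_size.
apply: (lexseg_nested (lexseg_shadow (@lexrank_seg N t (d t))) (@lexrank_seg N t.+1 (d t.+1))).
rewrite c; apply: (@leq_trans (count (shadow (leads I)) (mons N t.+1))).
  by apply: (macaulay (@lexrank_seg N t (d t))); rewrite c.
by apply: leq_count => m /size_mem_mons sm; exact: (leads_shadow idI sm).
Qed.

Lemma Lx_last t w x j : size w = n -> Lx t (rcons w x) -> sumn (rcons w x) = t -> Lx (t + j)%N (rcons w (x + j)%N).
Proof.
move=> sw h st; elim: j => [|j IH]; first by rewrite !addn0.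
rewrite !addnS; apply: Lx_shadow; last by rewrite shadow_rcons; apply/orP; right.
by rewrite mem_mons size_rcons sw eqxx -addnS -st !sumn_rcons addnA /= addnS.
Qed.

Lemma gotz_count t : (size b <= t)%N -> gotz b t = count (fun m => ~~ lexge m a) (mons N t).
Proof. by move=> bt; rewrite count_lex_compl. Qed.

Lemma size_a_le : (size a <= N)%N. Proof. by rewrite size_mult_vec. Qed.

Lemma lex_borel : borel_ideal N (lexge^~ a).
Proof. exact: lexge_borel size_a_le. Qed.

Lemma Lx_large : exists T, forall t, (T <= t)%N -> {in mons N t, Lx t =1 lexge^~ a}.
Proof.
have [t0 h] := hI; exists (maxn t0 (size b)) => t; rewrite geq_max => /andP[t0t bt].
have cd : d t = count (lexge^~ a) (mons N t).
  apply: (@addIn (count (predC (leads I)) (mons N t))); rewrite count_predC.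
  have /(hilb_funP idI) <- := h t t0t; rewrite gotz_count //.
  by rewrite -(count_predC (lexge^~ a)).
have cL : count (Lx t) (mons N t) = d t by apply: lexrank_count; apply: count_size.
have sL : lexseg_at N t (lexge^~ a) := lexge_seg size_a_le.
have sub := lexseg_nested (@lexrank_seg N t (d t)) sL.
by apply: eq_count_sub; [apply: sub|]; rewrite -/(Lx t) cL cd.
Qed.

(** In large degrees both sides have the same monomials ([Lx_large]), and a power of the last
    variable lifts any monomial there without affecting [lexge^~ a]. *)
Lemma sat_lex_idealP f : sat (lex_ideal I) f <-> monomial_span (lexge^~ a) f.
Proof.
have [T hT] := Lx_large; split=> [[K hK] m mf|hf].
  have e1 := size_expts m; case/lastP: (expts m) e1 (exptsK m) => // w x; rewrite size_rcons => -[sw] em.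
  pose u := mnm_of N (rcons (nseq n 0%N) K).
  have su : mdeg u = K by rewrite mdeg_mnm_of ?size_rcons ?size_nseq // sumn_rcons sumn_nseq0.
  have /lex_idealP/(_ (m + u)%MM) := hK u su.
  rewrite (perm_mem (msuppMX _ _)) addmC map_f // => /(_ isT).
  have eu : expts (u + m)%MM = rcons w (x + K)%N.
    rewrite -em -[RHS](@mnm_ofK N) ?size_rcons ?sw //; congr expts; apply/mnmP => l.
    rewrite mnmDE !mnmE !nth_rcons size_nseq sw; case: ltngtP => // [h|_]; last by rewrite addnC.
    by rewrite nth_nseq h.
  rewrite eu => Lu; have dm : sumn (rcons w (x + K)%N) = mdeg (u + m)%MM by rewrite -sumn_expts eu.
  have := Lx_last T sw Lu dm; rewrite hT ?leq_addl //; last first.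
    by rewrite mem_mons size_rcons sw eqxx -dm !sumn_rcons addnA /=.
  by rewrite /= !lexge_rconsl ?size_mult_vec ?sw.
exists T => u dT; apply/lex_idealP => m; rewrite (perm_mem (msuppMX _ _)) => /mapP[v vf ->].
rewrite hT ?mdegD ?dT ?leq_addr //; last by rewrite -dT -mdegD mem_expts.
by apply: lex_borel (hf v vf); rewrite ?size_expts // addmC; apply: dominates_expts_add.
Qed.

Lemma monomial_span_hilb_count A : borel_ideal N A -> (exists t0, forall t, (t0 <= t)%N ->
    count A (mons N t) = count (lexge^~ a) (mons N t)) -> has_hilb_poly (@monomial_span k N A) b.
Proof.
move=> bA [t0 ct]; apply/monomial_hilb; first exact: (proj1 (monomial_span_borel _ bA)).
exists (maxn t0 (size b)) => t; rewrite geq_max => /andP[t0t bt]; rewrite gotz_count //.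
apply: (@addnI (count (lexge^~ a) (mons N t))); rewrite (count_predC (lexge^~ a)) -(count_predC A) ct //.
by congr (_ + _)%N; apply: eq_in_count => s /size_mem_mons sN /=; rewrite monos_of_monid.
Qed.

Lemma hilb_count (J : {mpoly k[N]} -> Prop) : borel J -> has_hilb_poly J b ->
  exists t0, forall t, (t0 <= t)%N -> count (monos_of J) (mons N t) = count (lexge^~ a) (mons N t).
Proof.
move=> [mJ _] /(monomial_hilb b mJ) [t0 h]; exists (maxn t0 (size b)) => t; rewrite geq_max => /andP[t0t bt].
apply: (@addIn (count (predC (monos_of J)) (mons N t))); rewrite count_predC -h // gotz_count //.
by rewrite -(count_predC (lexge^~ a)).
Qed.

End LexIdeal.

(** * The uniqueness criterion and its numerical form *)

Lemma ideal_ext (k : fieldType) N (J J' : {mpoly k[N]} -> Prop) : (forall f, J f <-> J' f) -> J = J'.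
Proof.
by move=> e; apply: functional_extensionality => f; apply: propositional_extensionality.
Qed.

Lemma lex_unique_iff (k : fieldType) n b (I : {mpoly k[n.+2]} -> Prop) :
  is_ideal I -> has_hilb_poly I b -> sorted geq b -> all (fun x => x < n.+1)%N b ->
  let L := sat (lex_ideal I) in
  (borel L /\ saturated L /\ has_hilb_poly L b /\
    (forall J : {mpoly k[n.+2]} -> Prop,
       borel J -> saturated J -> has_hilb_poly J b -> forall f, J f <-> L f))
  <-> (count_mem 0%N b = 0%N \/ (size b <= (count_mem n b).+2)%N).
Proof.
move=> idI hI sb bn; rewrite (ideal_ext (sat_lex_idealP idI hI sb bn)) /=.
set a := mult_vec n.+1 b; have sa : size a = n.+1 := size_mult_vec n.+1 b.
have ta : sumn a = size b := sumn_mult_vec bn.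
have bL : borel_ideal n.+2 (lexge^~ a) by apply: lexge_borel; rewrite sa.
have fL : last_free n.+1 (lexge^~ a) by apply: lexge_last_free; rewrite sa.
split=> [[_ [_ [_ uniqL]]]|cond]; last first.
  split; first exact: monomial_span_borel.
  split; first exact: monomial_span_saturated.
  split; first by apply: monomial_span_hilb_count => //; exists 0%N.
  move=> J bJ sJ hJ f; have [t0 ct] := hilb_count sb bn bJ hJ.
  rewrite (monomial_monid f (proj1 bJ)).
  have cond' : last 0%N a = 0%N \/ (sumn a <= (head 0%N a).+2)%N by rewrite last_mult_vec ta.
  have E := lex_unique_comb (monos_of_borel bJ) (monos_of_last_free bJ sJ) sa ct cond'.
  by split=> h m /h; rewrite E ?size_expts.
case b0: (count_mem 0%N b) => [|z]; first by left.
right; rewrite leqNgt; apply/negP => big.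
(* In two variables every [b_j] is 0, so the first entry of [a] is already [size b], against
   [big]. *)
case: n => [|n] in I idI hI bn a sa ta bL fL uniqL big *.
  have : count_mem 0%N b = size b.
    by rewrite -count_predT; apply: eq_in_count => x /(allP bn) /=; rewrite ltnS leqn0.
  by move=> e; rewrite e in big; lia.
pose a' := belast (count_mem n.+1 b) (mult_vec n.+1 b).
have ea : a = rcons a' z.+1.
  by rewrite /a [mult_vec _ _]/= lastI -[_ :: mult_vec n b]/(mult_vec n.+1 b) last_mult_vec b0.
have sa' : size a' = n.+1 by rewrite size_belast size_mult_vec.
have [|J [bJ fJ hJ [m [sm Lm nJ]]]] := @lex_not_unique_comb n.+1 a' z sa' (ltn0Sn n).
  by rewrite [head _ _]/=; move: ta big; rewrite ea sumn_rcons; lia.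
rewrite -ea in hJ Lm.
have /(_ 'X_[mnm_of _ m]) :=
  uniqL (monomial_span J) (monomial_span_borel _ bJ) (monomial_span_saturated bJ fJ) (monomial_span_hilb_count k sb bn bJ hJ).
rewrite !monomial_spanX mnm_ofK // => -[_ /(_ Lm)] Jm.
by rewrite Jm in nJ.
Qed.

Lemma sorted_geq_last x s : path geq x s -> all (fun y => last x s <= y <= x)%N (x :: s).
Proof.
elim: s x => [|y s IH] x /=; first by rewrite !leqnn.
move=> /andP[yx /IH /= /andP[/andP[h1 _] h2]]; rewrite h1 leqnn (leq_trans h1 yx) yx /=.
by apply: sub_all h2 => z /andP[-> zy]; apply: leq_trans zy yx.
Qed.

(** Here [c.+1] is the codimension. As no entry exceeds the head, [count_mem (c + head 0 b) b] is
    [s] in codimension 1 and 0 in higher codimension. *)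
Lemma lex_unique_condP b c : b <> [::] -> sorted geq b ->
  lex_unique_cond b c.+1 <->
  (count_mem 0%N b = 0%N \/ (size b <= (count_mem (c + head 0%N b)%N b).+2)%N).
Proof.
case: b => // x s _ /sorted_geq_last; set b := x :: s => /allP hb.
have last_mem : last 0%N b \in b by exact: (mem_last x s).
have l0 : (0 < last 0%N b)%N <-> count_mem 0%N b = 0%N.
  split=> [lt|/count_memPn nb]; first by apply/count_memPn/negP => /hb /andP[]; rewrite leqNgt lt.
  by rewrite lt0n; apply: contraNneq nb => <-.
rewrite /lex_unique_cond l0; case: c => [|c]; last first.
  have -> : count_mem (c.+1 + head 0%N b)%N b = 0%N.
    by apply/count_memPn/negP => /hb /andP[_] /=; rewrite addSn ltnNge leq_addl.
  by split=> [[[_ h]|[]]|h] //; left.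
rewrite add0n; have e : (size b - count_mem (head 0%N b) b <= 2)%N = (size b <= (count_mem (head 0%N b) b).+2)%N.
  by rewrite leq_subLR addn2.
split=> [[[]|[_ [h|[h|h]]]]|h] //; first by left.
(* Equal first and last entries make all entries equal, so [s = r] and the bound holds. *)
- right; rewrite -[X in (X <= _)%N]count_predT (@eq_in_count _ predT (pred1 (head 0%N b))) ?leqW //.
  move=> y /hb; have hx : x = last x s := h.
  by rewrite -hx -eqn_leq eq_sym /= => ->.
- by right; rewrite -e.
right; split=> //; case: h => h; [by left|right; right].
by rewrite e.
Qed.

Theorem theorem7p4 (k : closedFieldType) (b : seq nat) (c : nat) :
  b <> [::] -> sorted geq b -> (0 < c)%N ->
  let n := (c + head 0%N b)%N in
  forall I : {mpoly k[n.+1]} -> Prop,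
    is_homog_ideal I -> has_hilb_poly I b ->
    let L := sat (lex_ideal I) in
    (borel L /\ saturated L /\ has_hilb_poly L b /\
      (forall J : {mpoly k[n.+1]} -> Prop,
         borel J -> saturated J -> has_hilb_poly J b -> forall f, J f <-> L f))
    <-> lex_unique_cond b c.
Proof.
case: c => // c b0 sb _ /= I [idI _] hI; rewrite lex_unique_condP //.
apply: lex_unique_iff => //.
case: b b0 sb {I idI hI} => // x s _ /sorted_geq_last /=.
rewrite leqnn andbT => /andP[_ h].
apply/andP; split; first by rewrite ltnS leq_addl.
by apply: sub_all h => y /andP[_ yx]; rewrite ltnS (leq_trans yx) ?leq_addl.
Qed.
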